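(* Let $(y,z)\in[\ell,r]^2$ with $y\ne z$ and define $$\Lambda^{y,z}:=\sup\{0<t<T_z: X_t=y\},$$ with the convention that the supremum of the empty set is $0$. Then the following statements are valid. (1) Let $x\in(\ell,r)$ and suppose $z>x\vee y$ with $s(z)<\infty$. Then $$(s(x)-s(y))^+=(s(z)-s(y))\,P^x(T_z<T_\ell,\ \Lambda^{y,z}=0).$$ Alternatively, $$(s(X_t)-s(y))^+=E^x\big[(s(X_{T_z})-s(y))^+\mathbf 1_{[\Lambda^{y,z}\le t]}\,\big|\,\mathcal F_t\big]\quad\text{on }[t<T_z].$$ (2) Let $x\in(\ell,r)$ and suppose $z<x\wedge y$ with $s(z)>-\infty$. Then $$(s(y)-s(x))^+=(s(y)-s(z))\,P^x(T_z<T_r,\ \Lambda^{y,z}=0).$$ Alternatively, $$(s(y)-s(X_t))^+=E^x\big[(s(y)-s(X_{T_z}))^+\mathbf 1_{[\Lambda^{y,z}\le t]}\,\big|\,\mathcal F_t\big]\quad\text{on }[t<T_z].$$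
   Context: Let $-\infty\le\ell<r\le\infty$ and let $X=(\Omega,\mathcal F,\mathcal F_t,X_t,\theta_t,P^x)$ be a regular one-dimensional diffusion on $(\ell,r)$ with no killing inside $(\ell,r)$ and absorbing boundaries, lifetime $\zeta=\inf\{t>0:X_t\in\{\ell,r\}\}$, and strictly increasing continuous scale function $s$, extended to $\ell,r$ by limits. $(\mathcal F_t)$ is the right-continuous universally completed natural filtration. For $y\in[\ell,r]$, $T_y:=\inf\{t>0:X_t=y\}$, with the infimum of the empty set equal to $\zeta$. When $T_z=\zeta$, $X_{T_z}$ is understood as $X_{\zeta-}$. When $z=r$ (resp. $z=\ell$), the event $[T_r<T_\ell]$ (resp. $[T_\ell<T_r]$) is understood as $[X_{\zeta-}=r]$ (resp. $[X_{\zeta-}=\ell]$). *)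

(* Defs.v *)
From HB Require Import structures.
From mathcomp Require Import all_boot all_order all_algebra.
From mathcomp Require Import all_classical all_reals all_analysis.
From mathcomp Require Import measurable_realfun.

Set Implicit Arguments.
Unset Strict Implicit.
Unset Printing Implicit Defensive.

Import Order.TTheory GRing.Theory Num.Theory.
Import numFieldNormedType.Exports.

Local Open Scope classical_set_scope.
Local Open Scope ring_scope.
Local Open Scope ereal_scope.

(* The state space is [l, r], as a subset of \bar R; time is {u : R | 0 <= u}.
   Values of X and theta at negative times, and of P and s outside [l, r],
   are never used. *)

Section paths.
Context (R : realType) (Omega : Type) (l r : \bar R) (X : R -> Omega -> \bar R).
Implicit Types (y z : \bar R) (w : Omega).

Definition lifetime w : \bar R :=
  ereal_inf [set u%:E | u in [set u : R | (0 < u)%R /\ (X u w = l \/ X u w = r)]].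

Definition hitting_set y w : set R := [set u : R | (0 < u)%R /\ X u w = y].

Definition hitting_time y w : \bar R :=
  if pselect (hitting_set y w !=set0)
  then ereal_inf [set u%:E | u in hitting_set y w]
  else lifetime w.

(* The filter of left neighbourhoods of the lifetime, which may be +oo. *)
Definition before_lifetime w : set_system \bar R :=
  within [set e | 0 <= e < lifetime w] (nbhs (lifetime w)).

(* [X_{zeta-} = z]; in particular the left limit exists. *)
Definition left_limit_is z : set Omega :=
  [set w | X (fine e) w @[e --> before_lifetime w] --> z].

Definition left_limit w : \bar R :=
  lim (X (fine e) w @[e --> before_lifetime w]).

Definition stopped_value z w : \bar R :=
  if hitting_time z w == lifetime w then left_limit w
  else X (fine (hitting_time z w)) w.

(* [T_z < T_b] for a boundary point b.  Since T_l = T_r = zeta, the strict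
   inequality would be void for z a boundary point, whence the case split. *)
Definition hits_before z b : set Omega :=
  if (z == l) || (z == r) then left_limit_is z
  else [set w | hitting_time z w < hitting_time b w].

(* The last visit to y before T_z.  The set consists of positive times, so
   the maximum with 0 only implements sup set0 = 0. *)
Definition last_passage y z w : \bar R :=
  maxe 0 (ereal_sup [set u%:E | u in [set u : R |
    [/\ (0 < u)%R, u%:E < hitting_time z w & X u w = y]]]).

Definition natural_sigma (J : set R) : set_system Omega :=
  <<s [set A | exists (u : R) (B : set \bar R),
    [/\ (0 <= u)%R, J u, measurable B & A = X u @^-1` B]] >>.

End paths.

Section filtration.
Context (R : realType) (d : measure_display) (Omega : measurableType d).
Context (l r : \bar R) (X : R -> Omega -> \bar R).
Context (P : \bar R -> probability Omega R).

Definition state_space : set \bar R := [set x | l <= x <= r].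

(* P^mu = \int P^x mu(dx) *)
Definition initial_law (mu : probability \bar R R) (A : set Omega) : \bar R :=
  \int[mu]_(x in state_space) P x A.

(* The sets which, for every initial law mu, differ from some element of G
   by a P^mu-null set; null sets are taken in sigma(X_u, u >= 0), so that for
   G = sigma(X_u, u <= t) this is the augmentation, not just the completion,
   of G. *)
Definition universal_completion (G : set_system Omega) : set_system Omega :=
  [set A | forall mu : probability \bar R R, mu state_space = 1 ->
    exists B N, [/\ G B, natural_sigma X setT N, initial_law mu N = 0
                  & (A `\` B) `|` (B `\` A) `<=` N]].

Definition filtration (t : R) : set_system Omega :=
  [set A | forall u : R, (t < u)%R ->
    universal_completion (natural_sigma X [set v | (v <= u)%R]) A].

Definition stopping_time (T : Omega -> \bar R) : Prop :=
  (forall w, 0 <= T w) /\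
  forall t : R, (0 <= t)%R -> filtration t [set w | T w <= t%:E].

Definition stopped_sigma (T : Omega -> \bar R) : set_system Omega :=
  [set A | measurable A /\
    forall t : R, (0 <= t)%R -> filtration t (A `&` [set w | T w <= t%:E])].

Definition strong_markov (theta : R -> Omega -> Omega) : Prop :=
  forall (x : \bar R) (T : Omega -> \bar R) (A E : set Omega),
    state_space x -> stopping_time T -> stopped_sigma T A ->
    natural_sigma X setT E ->
    P x (A `&` [set w | T w < +oo /\ E (theta (fine (T w)) w)]) =
    \int[P x]_(w in A `&` [set w | T w < +oo]) P (X (fine (T w)) w) E.

(* Continuity of the [l, r]-valued paths on the whole of [0, +oo[ also says
   that there is no killing inside ]l, r[: if zeta is finite, then the
   boundary point X_zeta is the left limit X_{zeta-}. *)
Record regular_diffusion (theta : R -> Omega -> Omega) : Prop := {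
  diffusion_sigma :
    @measurable d Omega = universal_completion (natural_sigma X setT);
  diffusion_state : forall (u : R) w, (0 <= u)%R -> state_space (X u w);
  diffusion_continuous : forall w,
    {within [set u : R | (0 <= u)%R], continuous (fun u => X u w)};
  diffusion_absorbing : forall (u v : R) w, (0 <= u <= v)%R ->
    X u w = l \/ X u w = r -> X v w = X u w;
  diffusion_shift : forall (u v : R) w, (0 <= u)%R -> (0 <= v)%R ->
    X u (theta v w) = X (u + v)%R w;
  diffusion_start : forall x, state_space x -> P x [set w | X 0%R w = x] = 1;
  diffusion_kernel : forall E, natural_sigma X setT E ->
    measurable_fun state_space (fun x => P x E);
  diffusion_strong_markov : strong_markov theta;
  diffusion_regular : forall x y, l < x < r -> l < y < r ->
    0 < P x [set w | hitting_time l r X y w < lifetime l r X w]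
}.

(* Continuity on [l, r] makes s l and s r the limits of s at l and r. *)
Record scale_function (s : \bar R -> \bar R) : Prop := {
  scale_fin_num : forall x, l < x < r -> s x \is a fin_num;
  scale_increasing : forall x y, l < x -> x < y -> y < r -> s x < s y;
  scale_continuous : {within state_space, continuous s};
  scale_exit : forall a x b, l < a -> a < x -> x < b -> b < r ->
    P x [set w | hitting_time l r X b w < hitting_time l r X a w] =
    ((fine (s x) - fine (s a)) / (fine (s b) - fine (s a)))%R%:E
}.

End filtration.

Section conditional_expectation.
Context (R : realType) (d : measure_display) (Omega : measurableType d).

(* V is a version of E[Z | G], for Z with values in [0, +oo]. *)
Definition is_cond_exp (Q : probability Omega R) (G : set_system Omega)
    (Z V : Omega -> \bar R) : Prop :=
  [/\ measurable_fun setT Z /\ (forall w, 0 <= Z w),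
      preimage_set_system setT V measurable `<=` G,
      forall w, 0 <= V w
    & forall A, G A -> \int[Q]_(w in A) V w = \int[Q]_(w in A) Z w].

(* Y = E[Z | G] almost surely on D. *)
Definition eq_cond_exp_on (Q : probability Omega R) (G : set_system Omega)
    (D : set Omega) (Y Z : Omega -> \bar R) : Prop :=
  exists2 V, is_cond_exp Q G Z V & {ae Q, forall w, D w -> Y w = V w}.

End conditional_expectation.

(* Main.v *)
From HB Require Import structures.
From mathcomp Require Import all_boot all_order all_algebra.
From mathcomp Require Import all_classical all_reals all_analysis.
From mathcomp Require Import measurable_realfun.
From mathcomp Require Import ring lra.
Require Import Defs.

(** Why the theorem is true.  Let y < z, and let z be above the starting point x,
    with s z < +oo.  For an interior y below x the first identity is the two-sided
    exit formula (s x - s y) / (s z - s y) of the scale function: that z is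
    reached with no visit to y in between means that z is reached before y.  The
    boundary cases follow by monotone limits.  For y = l, the event is the union
    over a > l of the events of reaching z before a (prob_hit_interior).  For
    z = r, it is the intersection over b < r of the events of reaching b before y,
    provided that a path which visits all b < r converges to r (prob_hit_top).
    This holds since, s r being finite, the probability of going from b down to a
    fixed c vanishes as b tends to r (ae_no_return).  For x <= y both sides are 0:
    a path from below y crosses y, and a path from y that never returns to y
    reaches z before every a < y, an event of probability
    (s y - s a) / (s z - s a), arbitrarily small (prob_clean_hit_below).  All this
    is collected in scale_formula.

    For the conditional expectation, let t < T_z.  The last passage at y is at
    most t iff y is not visited between t and T_z, and this is the event of the
    first identity for the path shifted by t.  By the Markov property and
    scale_formula at X_t, its conditional probability times s z - s y is
    (s(X_t) - s(y))^+ (cond_exp_clean_after).  It remains that (s(X) - s(y))^+ at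
    time T_z is s z - s y if z is reached, and 0 otherwise, because then the path
    tends to l almost surely (ae_hit_or_bottom).

    The case z < x is the previous one for the process - X, with scale function
    - s(- x).  That the latter is a scale function requires the probability of
    leaving ]a, b[ at a, where only that of leaving at b is given; the strong
    Markov property at the first visit to a shows that the two add up to 1
    (exit_left). *)

Set Implicit Arguments.
Unset Strict Implicit.
Unset Printing Implicit Defensive.

Import Order.TTheory GRing.Theory Num.Theory.
Import numFieldNormedType.Exports.

Local Open Scope classical_set_scope.
Local Open Scope ring_scope.
Local Open Scope ereal_scope.

(** * Continuous paths in the extended real line *)

Section path.
Context (R : realType) (f : R -> \bar R).
Implicit Types (u v p q : R) (a : \bar R).
Hypothesis fc : {within [set u : R | (0 <= u)%R], continuous f}.

Lemma path_near (u : R) (V : set (\bar R)) : (0 <= u)%R -> nbhs (f u) V ->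
  exists2 e : R, (0 < e)%R &
    forall v : R, (0 <= v)%R -> (`|v - u| < e)%R -> V (f v).
Proof.
move=> u0 fV; have /subspace_continuousP/(_ u u0 V fV) := fc.
move=> /nbhs_ballP[e /= e0 eV]; exists e => // v v0 vu.
by apply: eV => //; rewrite /ball /= distrC.
Qed.

Lemma path_lt (u : R) (a : \bar R) : (0 <= u)%R -> f u < a ->
  exists2 e : R, (0 < e)%R &
    forall v : R, (0 <= v)%R -> (`|v - u| < e)%R -> f v < a.
Proof.
by move=> u0 ua; apply: (path_near (V := [set x | x < a])) => //;
  apply: open_ereal_lt'.
Qed.

Lemma path_gt (u : R) (a : \bar R) : (0 <= u)%R -> a < f u ->
  exists2 e : R, (0 < e)%R &
    forall v : R, (0 <= v)%R -> (`|v - u| < e)%R -> a < f v.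
Proof.
by move=> u0 ua; apply: (path_near (V := [set x | a < x])) => //;
  apply: open_ereal_gt'.
Qed.

Lemma path_ne (u : R) (a : \bar R) : (0 <= u)%R -> f u <> a ->
  exists2 e : R, (0 < e)%R &
    forall v : R, (0 <= v)%R -> (`|v - u| < e)%R -> f v <> a.
Proof.
move=> u0 /eqP; rewrite neq_lt => /orP[] h.
- have [e e0 H] := path_lt u0 h.
  by exists e => // v v0 /(H v v0) hv E; rewrite E ltxx in hv.
- have [e e0 H] := path_gt u0 h.
  by exists e => // v v0 /(H v v0) hv E; rewrite E ltxx in hv.
Qed.

Lemma contract_path_continuous (p q : R) : (0 <= p)%R ->
  {within `[p, q], continuous (fun u => contract (f u))}.
Proof.
move=> p0; apply: (@continuous_subspaceW _ _ _ [set u : R | (0 <= u)%R]).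
  by move=> u /=; rewrite in_itv /= => /andP[/(le_trans p0)].
apply/subspace_continuousP => u /= u0 V /nbhs_ballP[e /= e0 eV].
have /subspace_continuousP/(_ u u0 (ball (f u) e)) := fc.
move=> /(_ (nbhsx_ballx _ _ e0)); rewrite !nbhs_simpl /=.
by apply: filterS => v huv; exact: eV.
Qed.

Lemma path_IVT (p q : R) (a : \bar R) : (0 <= p)%R -> (p <= q)%R ->
  (f p <= a <= f q) || (f q <= a <= f p) ->
  exists2 u : R, (p <= u <= q)%R & f u = a.
Proof.
move=> p0 pq H.
have [||u] := @IVT R (fun u => contract (f u)) p q (contract a) pq.
- exact: contract_path_continuous.
- rewrite /= ge_min le_max !le_contract.
  by case/orP: H => /andP[-> ->] //; rewrite !orbT.
- by rewrite in_itv /= => u1 /contract_inj; exists u.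
Qed.

(** Compactness of [p, q] turns the existence of a visit into a countable
    condition: the distance to a, which is continuous along the path, attains
    its minimum and is therefore as small as wished at rational proportions of
    the interval. *)
Lemma visit_approx (p q : R) (a : \bar R) : (0 <= p)%R -> (p <= q)%R ->
  (exists2 u : R, (p <= u <= q)%R & f u = a) <->
  forall n : nat, exists2 k : rat, (0 <= (ratr k : R) <= 1)%R &
    (`|contract (f (p + (q - p) * ratr k)) - contract a| < n.+1%:R^-1)%R.
Proof.
move=> p0 pq; pose g u := (`|contract (f u) - contract a|)%R; split.
  move=> [u /andP[pu uq] fu] n.
  have u0 : (0 <= u)%R := le_trans p0 pu.
  have /subspace_continuousP/(_ u u0 (ball (f u) n.+1%:R^-1)) := fc.
  have n0 : (0 < n.+1%:R^-1 :> R)%R by rewrite invr_gt0.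
  move=> /(_ (nbhsx_ballx _ _ n0)) /nbhs_ballP[e /= e0 he].
  have [pq'|pq'] := eqVneq p q.
    exists 0%R; first by rewrite rmorph0 lexx ler01.
    rewrite rmorph0 mulr0 addr0.
    have -> : p = u by apply/eqP; rewrite eq_le pu pq'.
    by rewrite fu subrr normr0.
  have {}pq' : (0 < q - p)%R by rewrite subr_gt0 lt_neqAle pq' pq.
  (* a rational proportion close to that of u, on the side of the interior *)
  pose c := ((u - p) / (q - p))%R; pose d := (e / (q - p))%R.
  have d0 : (0 < d)%R by rewrite divr_gt0.
  have c01 : (0 <= c <= 1)%R.
    by rewrite /c divr_ge0 ?ler_pdivrMr ?mul1r ?lerB// subr_ge0// ltW.
  have [k /= hk1 hk2] : exists2 k : rat, (0 <= (ratr k : R) <= 1)%R &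
      (`|ratr k - c| < d)%R.
    case/andP: c01 => c0 c1; have [c1'|c1'] := ltP c 1%R.
      have cm : (c < Num.min 1 (c + d))%R by rewrite lt_min c1' ltrDl.
      have [k] := rat_in_itvoo cm.
      rewrite in_itv /= lt_min => /and3P[ck k1 kd].
      exists k; first by rewrite (le_trans c0 (ltW ck)) ltW.
      by rewrite gtr0_norm ?subr_gt0// ltrBlDl.
    exists 1%R; rewrite rmorph1 ?ler01 ?lexx//.
    by have -> : c = 1%R; [apply/eqP; rewrite eq_le c1| rewrite subrr normr0].
  exists k => //; have hq : (u = p + (q - p) * c)%R.
    by rewrite /c mulrCA divff ?gt_eqF// mulr1 addrC subrK.
  rewrite -fu distrC; apply: he => /=.
    rewrite /ball /= {1}hq opprD addrACA subrr add0r -mulrBr normrM gtr0_norm//.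
    by rewrite distrC mulrC -ltr_pdivlMr.
  rewrite addr_ge0// mulr_ge0 ?(ltW pq')//.
  by case/andP: hk1.
move=> H.
have gc : {within `[p, q], continuous g}.
  move=> x; apply: cvg_norm; apply: cvgB; last exact: cvg_cst.
  exact: contract_path_continuous.
have [c] := EVT_min pq gc; rewrite in_itv /= => cpq cmin.
exists c => //; apply: contract_inj; apply/eqP; rewrite -subr_eq0.
rewrite -normr_eq0 eq_le normr_ge0 andbT leNgt; apply/negP => gc0.
have [n hn] := ltr_add_invr gc0; rewrite add0r in hn.
have [k /andP[k0 k1] hk] := H n.
have := lt_trans hk hn; rewrite ltNge => /negP; apply; apply: cmin.
rewrite in_itv /= lerDl mulr_ge0 ?subr_ge0//=.
by rewrite -lerBrDl ler_piMr// subr_ge0.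
Qed.

Lemma first_visit (p q : R) (a : \bar R) : (0 <= p)%R -> (p <= q)%R -> f q = a ->
  exists t, [/\ (p <= t <= q)%R, f t = a &
    forall u, (p <= u)%R -> (u < t)%R -> f u <> a].
Proof.
move=> p0 pq fq; pose V := [set u | (p <= u)%R /\ f u = a].
have Vq : V q by [].
have hV : has_inf V by split; [exists q | exists p => u []].
exists (inf V); have pV : (p <= inf V)%R.
  by apply: lb_le_inf; [exists q | move=> u []].
have bel u : (p <= u)%R -> (u < inf V)%R -> f u <> a.
  move=> pu uV fu; move: uV; rewrite ltNge => /negP; apply.
  by apply: ge_inf; [exists p => v []|].
split => //; first by rewrite pV /=; apply: ge_inf => //; exists p => u [].
apply: contrapT => /(path_ne (le_trans p0 pV))[e e0 he].
have [v [pv fv] ve] := inf_adherent e0 hV.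
have Vv : (inf V <= v)%R by apply: ge_inf; [exists p => w []|].
apply: (he v) => //; first exact: le_trans pv.
by rewrite ger0_norm ?subr_ge0// ltrBlDr addrC.
Qed.

End path.

Lemma path_min (R : realType) (f : R -> \bar R) (p q : R) :
  {within [set u : R | (0 <= u)%R], continuous f} -> (0 <= p)%R -> (p <= q)%R ->
  exists2 c : R, (p <= c <= q)%R & forall u, (p <= u <= q)%R -> f c <= f u.
Proof.
move=> fc p0 pq; have [c] := EVT_min pq (contract_path_continuous fc (q := q) p0).
rewrite in_itv /= => hc cmin; exists c => // u hu.
by rewrite -le_contract; apply: cmin; rewrite in_itv.
Qed.

Lemma path_max (R : realType) (f : R -> \bar R) (p q : R) :
  {within [set u : R | (0 <= u)%R], continuous f} -> (0 <= p)%R -> (p <= q)%R ->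
  exists2 c : R, (p <= c <= q)%R & forall u, (p <= u <= q)%R -> f u <= f c.
Proof.
move=> fc p0 pq; have [c] := EVT_max pq (contract_path_continuous fc (q := q) p0).
rewrite in_itv /= => hc cmin; exists c => // u hu.
by rewrite -le_contract; apply: cmin; rewrite in_itv.
Qed.

(** * Hitting times and last passage times along one path *)

Definition tends_up (R : realType) (r : \bar R) (f : R -> \bar R) : Prop :=
  forall c, c < r -> exists n : nat, forall u, (n%:R <= u)%R -> c < f u.

(** To reach r means to converge to r, in finite or infinite time, whereas an
    interior point is reached at a time v.  Time t itself does not count: a path
    that is at y at time t is only required not to return to y. *)
Definition clean_hit (R : realType) (r y z : \bar R) (t : R)
    (f : R -> \bar R) : Prop :=
  if z == r then tends_up r f /\ forall u, (t < u)%R -> f u <> y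
  else exists v, [/\ (t < v)%R, f v = z &
         forall u, (t < u)%R -> (u <= v)%R -> f u <> y].

Section one_path.
Context (R : realType) (Omega : Type) (l r : \bar R) (X : R -> Omega -> \bar R).
Variable w : Omega.
Implicit Types (u v t : R) (a b y z : \bar R).
Hypothesis hlr : l < r.
Hypothesis fs : forall u : R, (0 <= u)%R -> l <= X u w <= r.
Hypothesis fc : {within [set u : R | (0 <= u)%R], continuous (X ^~ w)}.
Hypothesis fa : forall u v : R, (0 <= u <= v)%R ->
  X u w = l \/ X u w = r -> X v w = X u w.

Local Notation zeta := (lifetime l r X w).
Local Notation T := (hitting_time l r X).

Lemma lifetime_ge0 : 0 <= zeta.
Proof. by apply: le_ereal_inf_tmp => _ [u [u0 _] <-]; rewrite lee_fin ltW. Qed.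

(** If u were past the lifetime then, by absorption and by continuity, the path
    would already be at the boundary at time u. *)
Lemma lifetime_gt u : (0 <= u)%R -> l < X u w < r -> u%:E < zeta.
Proof.
move=> u0 /andP[lu ur].
have [e1 e10 h1] := path_gt fc u0 lu; have [e2 e20 h2] := path_lt fc u0 ur.
pose e := Num.min e1 e2; have e0 : (0 < e)%R by rewrite lt_min e10.
apply: (@lt_le_trans _ _ (u + e)%:E); first by rewrite lte_fin ltrDl.
apply: le_ereal_inf_tmp => _ [v [v0 bv] <-]; rewrite lee_fin leNgt.
apply/negP => ve; have [vu|uv] := leP v u.
  have := @fa v u; rewrite vu ltW//= => /(_ isT bv) E.
  by move: lu ur; rewrite E; case: bv => ->; rewrite ltxx.
have d : (`|v - u| < e)%R by rewrite gtr0_norm ?subr_gt0// ltrBlDl.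
move: d; rewrite lt_min => /andP[d1 d2].
move: (h1 v (ltW v0) d1) (h2 v (ltW v0) d2).
by case: bv => ->; rewrite ltxx.
Qed.

Lemma lifetime_le u : (0 < u)%R -> ~ l < X u w < r -> zeta <= u%:E.
Proof.
move=> u0 H; apply: ereal_inf_lbound; exists u => //; split => //.
have /andP[lu ur] := fs (ltW u0).
move: lu ur; rewrite !le_eqVlt => /predU1P[->|lu]; first by left.
by move=> /predU1P[->|ur]; [right | case: H; rewrite lu].
Qed.

Lemma lifetime_dead u : (0 < u)%R -> zeta <= u%:E -> X u w = l \/ X u w = r.
Proof.
move=> u0 H; apply: contrapT => /not_orP[nl nr].
have : u%:E < zeta.
  apply: lifetime_gt; first exact: ltW.
  have /andP[lu ur] := fs (ltW u0).
  by rewrite !lt_neqAle lu ur !andbT eq_sym; apply/andP; split; apply/eqP.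
by rewrite ltNge H.
Qed.

Lemma lifetime_alive0 : l < X 0%R w < r -> 0 < zeta.
Proof. by move=> h; apply: lifetime_gt. Qed.

Lemma lifetime_dead0 : ~ l < X 0%R w < r -> zeta = 0.
Proof.
move=> H; apply/eqP; rewrite eq_le lifetime_ge0 andbT.
apply/lee_addgt0Pr => e e0; rewrite add0e; apply: lifetime_le => // h.
have b0 : X 0%R w = l \/ X 0%R w = r.
  have /andP[lu ur] := fs (lexx 0%R).
  move: lu ur; rewrite !le_eqVlt => /predU1P[->|lu]; first by left.
  by move=> /predU1P[->|ur]; [right | case: H; rewrite lu].
have E : X e w = X 0%R w by apply: fa => //; rewrite lexx ltW.
by move: h; rewrite E; case: b0 => ->; rewrite ltxx ?andbF.
Qed.

Lemma hitting_time_le z u : (0 < u)%R -> X u w = z -> T z w <= u%:E.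
Proof.
move=> u0 Xu; rewrite /hitting_time; case: pselect => [vis|n] /=; last by case: n; exists u.
by apply: ereal_inf_lbound; exists u.
Qed.

Lemma hitting_time_ge0 z : 0 <= T z w.
Proof.
rewrite /hitting_time; case: pselect => ? /=; last exact: lifetime_ge0.
by apply: le_ereal_inf_tmp => _ [u [u0 _] <-]; rewrite lee_fin ltW.
Qed.

Lemma hitting_time_le_lifetime z : l <= z <= r -> T z w <= zeta.
Proof.
move=> /andP[lz zr]; rewrite /hitting_time.
case: pselect => //= -[u [u0 Xu]].
have [zi|zb] := pselect (l < z < r).
  apply: (@le_trans _ _ u%:E); first by apply: ereal_inf_lbound; exists u.
  by apply/ltW/lifetime_gt; rewrite ?Xu// ltW.
have {}zb : z = l \/ z = r.
  move: lz zr; rewrite !le_eqVlt => /predU1P[->|lz]; first by left.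
  by move=> /predU1P[->|zr]; [right | case: zb; rewrite lz].
apply: ereal_inf_le_tmp => _ [v [v0 bv] <-]; exists v => //; split => //.
have uz : X u w = l \/ X u w = r by rewrite Xu.
have [uv|vu] := leP u v.
  by rewrite (fa (u := u)) ?uv ?ltW.
by rewrite -Xu; apply/esym/fa => //; rewrite !ltW.
Qed.

Lemma hitting_time_boundary z : z = l \/ z = r -> T z w = zeta.
Proof.
move=> bz; apply/eqP; rewrite eq_le; apply/andP; split.
  by apply: hitting_time_le_lifetime; case: bz => ->; rewrite lexx ltW.
rewrite /hitting_time; case: pselect => //= vis.
apply: ereal_inf_le_tmp => _ [v [v0 bv] <-]; exists v => //; split => //.
by rewrite bv.
Qed.

Lemma visited_of_hitting_time_lt z : T z w < zeta ->
  exists2 v, (0 < v)%R & X v w = z.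
Proof.
rewrite /hitting_time; case: pselect => [[v [v0 Xv]]|novis] /=; first by exists v.
by rewrite ltxx.
Qed.

Lemma visited_before z (c : \bar R) : T z w < c -> c <= zeta ->
  exists v, [/\ (0 < v)%R, v%:E < c & X v w = z].
Proof.
rewrite /hitting_time; case: pselect => [[v [v0 Xv]]|novis] /=.
  by move=> /ereal_inf_lt[_ [u [u0 Xu] <-] uc] _; exists u.
by move=> h1 /(lt_le_trans h1); rewrite ltxx.
Qed.

Lemma hitting_lt_interior a b : l < a < r -> l < b < r -> a <> b ->
  (T b w < T a w) <->
  exists v, [/\ (0 < v)%R, X v w = b &
    forall u, (0 < u)%R -> (u <= v)%R -> X u w <> a].
Proof.
move=> ha hb ab; split.
  have hle : T a w <= zeta.
    by apply: hitting_time_le_lifetime; case/andP: ha => ? ?; rewrite !ltW.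
  move=> /visited_before /(_ hle)[v [v0 va Xv]]; exists v; split => // u u0 uv Xu.
  have := hitting_time_le u0 Xu; rewrite leNgt => /negP; apply.
  by apply: le_lt_trans va; rewrite lee_fin.
move=> [v [v0 Xv nv]]; apply: le_lt_trans (hitting_time_le v0 Xv) _.
rewrite /hitting_time; case: pselect => [vis|novis] /=; last first.
  by apply: lifetime_gt; [exact: ltW | rewrite Xv].
have /(path_ne fc (ltW v0))[e e0 he] : X v w <> a by rewrite Xv => /esym.
apply: (@lt_le_trans _ _ (v + e)%:E); first by rewrite lte_fin ltrDl.
apply: le_ereal_inf_tmp => _ [u [u0 Xu] <-]; rewrite lee_fin leNgt.
apply/negP => ue; have [uv|vu] := leP u v; first exact: (nv u).
apply: (he u) => //; first exact: ltW.
by rewrite gtr0_norm ?subr_gt0// ltrBlDl.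
Qed.

Lemma hitting_lt_boundary z b : l < z < r -> b = l \/ b = r ->
  (T z w < T b w) <-> exists2 v, (0 < v)%R & X v w = z.
Proof.
move=> hz /hitting_time_boundary ->; split; first exact: visited_of_hitting_time_lt.
move=> [v v0 Xv]; apply: le_lt_trans (hitting_time_le v0 Xv) _.
by apply: lifetime_gt; [exact: ltW | rewrite Xv].
Qed.

Lemma hitting_time_first z t : (0 < t)%R -> X t w = z ->
  (forall u, (0 <= u)%R -> (u < t)%R -> X u w <> z) -> T z w = t%:E.
Proof.
move=> t0 Xt nt; apply/eqP; rewrite eq_le hitting_time_le//=.
rewrite /hitting_time; case: pselect => [vis|n] /=; last by case: n; exists t.
apply: le_ereal_inf_tmp => _ [u [u0 Xu] <-]; rewrite lee_fin leNgt.
by apply/negP => ut; apply: (nt u) => //; exact: ltW.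
Qed.

Lemma last_passage_le y z (t : R) : (0 <= t)%R ->
  (last_passage l r X y z w <= t%:E) <->
  forall u, (t < u)%R -> u%:E < T z w -> X u w <> y.
Proof.
move=> t0; rewrite /last_passage ge_max lee_fin t0 /=; split.
  move=> /ereal_supP H u tu uT Xu.
  have : u%:E <= t%:E by apply: H; exists u => //; split => //; exact: le_lt_trans tu.
  by rewrite lee_fin leNgt tu.
move=> H; apply: ge_ereal_sup => _ [u [u0 uT Xu] <-]; rewrite lee_fin leNgt.
by apply/negP => tu; exact: (H u).
Qed.

Lemma not_visited_of_hitting_time_gt z (t u : R) : X 0%R w <> z ->
  (0 <= u)%R -> (u <= t)%R -> t%:E < T z w -> X u w <> z.
Proof.
move=> X0 u0 ut tT Xu.
have {}u0 : (0 < u)%R.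
  by rewrite lt_neqAle u0 andbT; apply/eqP => u0'; apply: X0; rewrite u0'.
by have := lt_le_trans tT (hitting_time_le u0 Xu); rewrite lte_fin ltNge ut.
Qed.

End one_path.

(** * The left limit at the lifetime *)

Lemma nbhs_left_end (R : realType) (l r : \bar R) (V : set (\bar R)) :
  l < r -> nbhs r V -> exists2 c, c < r & forall x, c < x -> x <= r -> V x.
Proof.
case: r => [r|_|]; last by rewrite ltNge leNye.
- move=> _ H; have /nbhs_ballP[e /= e0 eV] : nbhs r (fun x => V x%:E) := H.
  exists (r - e)%:E.
    by rewrite lte_fin ltrBlDr ltrDl.
  move=> [x|//|//]; rewrite lte_fin lee_fin => rex xr; apply: eV.
  rewrite /ball /= ger0_norm ?subr_ge0//.
  by rewrite ltrBlDr -ltrBlDl.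
- move=> [M [Mr MV]]; exists M%:E; first by rewrite ltry.
  by move=> x Mx _; exact: MV.
Qed.

Section left_limit.
Context (R : realType) (Omega : Type) (l r : \bar R) (X : R -> Omega -> \bar R).
Variable w : Omega.
Implicit Types (u v t : R) (a b y z : \bar R).
Hypothesis hlr : l < r.
Hypothesis fs : forall u : R, (0 <= u)%R -> l <= X u w <= r.
Hypothesis fc : {within [set u : R | (0 <= u)%R], continuous (X ^~ w)}.
Hypothesis fa : forall u v : R, (0 <= u <= v)%R ->
  X u w = l \/ X u w = r -> X v w = X u w.

Local Notation zeta := (lifetime l r X w).
Local Notation T := (hitting_time l r X).

Lemma before_lifetime_proper : 0 < zeta ->
  ProperFilter (before_lifetime l r X w).
Proof.
move=> z0; apply: Build_ProperFilter_ex.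
  rewrite /before_lifetime => P.
  case: zeta z0 => [t|_|//].
  - rewrite lte_fin => t0 H.
    have /nbhs_ballP[e /= e0 eP] : nbhs t (fun x => 0 <= x%:E < t%:E -> P x%:E) := H.
    pose d := (Num.min (e / 2) (t / 2))%R.
    have d0 : (0 < d)%R by rewrite lt_min !divr_gt0.
    have dt : (d <= t / 2)%R by rewrite ge_min lexx orbT.
    have de : (d <= e / 2)%R by rewrite ge_min lexx.
    exists (t - d)%:E; apply: eP => /=.
      rewrite /ball /= opprD addNKr opprK gtr0_norm//; lra.
    by apply/andP; split; rewrite ?lee_fin ?lte_fin; lra.
  - move=> [M [Mr MP]]; exists (Num.max M 0 + 1)%:E; apply: MP.
      by rewrite lte_fin; case: (leP M 0%R) => h; lra.
    apply/andP; split; rewrite ?ltry// lee_fin.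
    by case: (leP M 0%R) => h; lra.
Qed.

(** The left limit at the lifetime is a limit at infinity in all cases: if the
    lifetime is finite then, by absorption, the path is constant afterwards. *)
Lemma left_limit_cvg a : 0 < zeta ->
  (X (fine e) w @[e --> before_lifetime l r X w] --> a) <->
  (X u w @[u --> +oo%R] --> a).
Proof.
move=> z0; have PF := before_lifetime_proper z0.
move: (PF) z0 (@lifetime_dead _ _ l r X w fs fc fa).
rewrite /before_lifetime; case: zeta => [t|PF' _ _|//].
- move=> PF' t0 dead; rewrite lte_fin in t0.
  have c1 : X (fine e) w @[e --> within [set e | 0 <= e < t%:E] (nbhs t%:E)]
      --> X t w.
    move=> V /(path_near fc (ltW t0))[e e0 he].
    suff : nbhs t (fun x => 0 <= x%:E < t%:E -> V (X x w)) by [].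
    apply/nbhs_ballP; exists e => //= s /= st /andP[s0 _]; apply: he => //.
    by rewrite distrC.
  have c2 : X u w @[u --> +oo%R] --> X t w.
    apply: (@cvg_near_cst _ _ _ _ +oo%R).
    near=> u; apply: fa => //.
      by rewrite ltW//=; near: u; exact: nbhs_pinfty_ge.
    by apply: dead.
  split=> H.
    by rewrite (cvg_unique (@ereal_hausdorff R) H c1).
  by rewrite (cvg_unique (@ereal_hausdorff R) H c2).
- split=> H V /H.
    move=> [M [Mr MP]]; exists (Num.max M 0)%R; split; first exact: num_real.
    move=> u; rewrite gt_max => /andP[Mu u0]; apply: (MP u%:E) => /=.
      by rewrite lte_fin.
    by apply/andP; split; rewrite ?ltry// lee_fin ltW.
  move=> [M [Mr MP]]; exists M; split => //.
  by move=> [u Mu _|_ /andP[_]|//]; [exact: MP | rewrite ltxx].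
Unshelve. all: by end_near. Qed.

Lemma tends_upP : tends_up r (X ^~ w) <-> X u w @[u --> +oo%R] --> r.
Proof.
split=> H.
  move=> V /(nbhs_left_end hlr)[c /H[n hn] cV].
  exists (n%:R)%R; split; first exact: num_real.
  move=> u nu; have u0 : (0 <= u)%R by apply: le_trans (ltW nu).
  apply: cV; first by apply: hn; exact: ltW.
  by case/andP: (fs u0).
move=> c cr; have [M [Mr MP]] := H [set x | c < x] (open_ereal_gt' cr).
exists (Num.bound `|M|)%R => u nu; apply: MP; apply: lt_le_trans nu.
by apply: le_lt_trans (ler_norm M) _; apply: archi_boundP.
Qed.

Lemma left_limit_value b : 0 < zeta -> left_limit_is l r X b w ->
  left_limit l r X w = b.
Proof.
move=> z0; have PF := before_lifetime_proper z0; rewrite /left_limit_is /= => H.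
exact: (cvg_lim (@ereal_hausdorff R)).
Qed.

End left_limit.

(** * The value at the hitting time and the last passage *)

Section terminal_value.
Context (R : realType) (Omega : Type) (l r : \bar R) (X : R -> Omega -> \bar R).
Variable w : Omega.
Implicit Types (u v t : R) (a b y z : \bar R).
Hypothesis hlr : l < r.
Hypothesis fs : forall u : R, (0 <= u)%R -> l <= X u w <= r.
Hypothesis fc : {within [set u : R | (0 <= u)%R], continuous (X ^~ w)}.
Hypothesis fa : forall u v : R, (0 <= u <= v)%R ->
  X u w = l \/ X u w = r -> X v w = X u w.
Hypothesis alive0 : l < X 0%R w < r.

Local Notation zeta := (lifetime l r X w).
Local Notation T := (hitting_time l r X).

Let zeta_gt0 : 0 < zeta.
Proof. exact: lifetime_alive0. Qed.

Lemma hits_before_interior z b : z != l -> z != r ->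
  hits_before l r X z b w = (T z w < T b w).
Proof. by rewrite /hits_before => /negbTE -> /negbTE ->. Qed.

Lemma hits_before_boundary z b : z = l \/ z = r ->
  hits_before l r X z b w = left_limit_is l r X z w.
Proof. by rewrite /hits_before => -[] ->; rewrite eqxx ?orbT. Qed.

Lemma stopped_value_hit z b : l <= z <= r -> b = l \/ b = r ->
  X 0%R w <> z -> hits_before l r X z b w -> stopped_value l r X z w = z.
Proof.
move=> /andP[lz zr] bb X0.
have [zb|zi] := pselect (z = l \/ z = r).
  rewrite hits_before_boundary// => H; rewrite /stopped_value.
  by rewrite hitting_time_boundary// eqxx (left_limit_value zeta_gt0 H).
have {lz zr}zi : l < z < r.
  by move: zi lz zr; rewrite !le_eqVlt => zi /predU1P[e|->] /predU1P[e'|->] //;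
    case: zi; by [left | right].
rewrite hits_before_interior; last 2 first.
- by case/andP: zi => h _; rewrite gt_eqF.
- by case/andP: zi => _ h; rewrite lt_eqF.
move=> /(hitting_lt_boundary hlr fc fa zi bb)[v v0 Xv].
have [t [/andP[t0 tv] Xt nt]] := first_visit fc (lexx 0%R) (ltW v0) Xv.
have {}t0 : (0 < t)%R.
  by rewrite lt_neqAle t0 andbT; apply/eqP => E; apply: X0; rewrite E.
rewrite /stopped_value (hitting_time_first l r t0 Xt) //=.
by rewrite lt_eqF// lifetime_gt ?Xt ?ltW.
Qed.

Lemma stopped_value_miss z b : left_limit_is l r X b w -> T z w = zeta ->
  stopped_value l r X z w = b.
Proof. by move=> H E; rewrite /stopped_value E eqxx (left_limit_value zeta_gt0 H). Qed.

(** If z is not visited up to time t, then the event on the left, although it is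
    defined from the whole path, depends on the path after t only.  This is what
    brings the Markov property at time t into play. *)
Lemma hits_before_last_passageP y z (t : R) : (0 <= t)%R ->
  l < z <= r -> l <= y < z ->
  (forall u, (0 <= u)%R -> (u <= t)%R -> X u w <> z) ->
  (hits_before l r X z l w /\ last_passage l r X y z w <= t%:E) <->
  clean_hit r y z t (X ^~ w).
Proof.
move=> t0 /andP[lz zr] /andP[ly yz] nz.
rewrite last_passage_le// /clean_hit.
have [zr'|zr'] := eqVneq z r.
  subst z; rewrite hits_before_boundary; last by right.
  rewrite hitting_time_boundary//; last by right.
  rewrite /left_limit_is /= left_limit_cvg// -(tends_upP hlr fs)//.
  split=> -[H1 H2]; split => // u tu; last by move=> _; exact: H2.
  move=> Xu; have u0 : (0 < u)%R by exact: le_lt_trans tu.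
  have [zu|uz] := leP zeta u%:E; last by case: (H2 u tu uz).
  have b := lifetime_dead fs fc fa u0 zu.
  have [n hn] := H1 _ yz.
  have := hn (Num.max n%:R u)%R; rewrite le_max lexx => /(_ isT).
  by rewrite (fa _ b) ?Xu ?ltxx// le_max lexx orbT ltW.
have hz : l < z < r by rewrite lz lt_neqAle zr' zr.
rewrite hits_before_interior ?zr' ?gt_eqF//.
rewrite (hitting_lt_boundary hlr fc fa hz (or_introl erefl)); split.
- move=> [[v v0 Xv] H].
  have [s [/andP[s0 sv] Xs ns]] := first_visit fc (lexx 0%R) (ltW v0) Xv.
  have ts : (t < s)%R by rewrite ltNge; apply/negP => /(nz _ s0).
  have {}s0 : (0 < s)%R := le_lt_trans t0 ts.
  exists s; split => // u tu; rewrite le_eqVlt => /predU1P[->|us] Xu.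
    by move: yz; rewrite -Xu Xs ltxx.
  apply: (H u tu) => //.
  by rewrite (hitting_time_first l r s0 Xs).
- move=> [v [tv Xv H]]; have v0 : (0 < v)%R := le_lt_trans t0 tv.
  split; first by exists v.
  move=> u tu uT; apply: H => //.
  by have := lt_le_trans uT (hitting_time_le l r v0 Xv); rewrite lte_fin => /ltW.
Qed.

(** The last passage at y precedes the hitting time of z, hence any visit to z at
    a positive time. *)
Lemma hits_before_visited y z (t u : R) : l < z <= r -> X 0%R w <> z ->
  (0 <= u)%R -> (u <= t)%R -> X u w = z ->
  hits_before l r X z l w /\ last_passage l r X y z w <= t%:E.
Proof.
move=> /andP[lz zr] X0 u0 ut Xu.
have {}u0 : (0 < u)%R.
  by rewrite lt_neqAle u0 andbT; apply/eqP => E; apply: X0; rewrite E.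
have Tu := hitting_time_le l r u0 Xu.
have t0 : (0 <= t)%R by rewrite (le_trans (ltW u0)).
split; last first.
  apply/last_passage_le => // v tv vT.
  have := lt_le_trans vT Tu; rewrite lte_fin => vu.
  by move: (lt_le_trans (lt_trans tv vu) ut); rewrite ltxx.
have [zr'|zr'] := eqVneq z r.
  rewrite zr' in Xu *; rewrite hits_before_boundary; last by right.
  rewrite /left_limit_is /= left_limit_cvg// -(tends_upP hlr fs)// => c cr.
  exists (Num.bound u) => v nv; rewrite (fa (u := u)) ?Xu//; last by right.
  rewrite ltW//=; apply/ltW/(lt_le_trans _ nv).
  by apply: archi_boundP; exact: ltW.
have hz : l < z < r by rewrite lz lt_neqAle zr' zr.
rewrite hits_before_interior ?zr' ?gt_eqF//.
by apply/(hitting_lt_boundary hlr fc fa hz (or_introl erefl)); exists u.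
Qed.

End terminal_value.

(** * Measurability of path events *)

(** Such a set is a ray from its infimum, open or closed. *)
Lemma measurable_upper (R : realType) (U : set (\bar R)) :
  (forall x y : \bar R, x <= y -> U x -> U y) -> measurable U.
Proof.
move=> Uup; have [Um|Um] := pselect (U (ereal_inf U)).
  suff -> : U = `[ereal_inf U, +oo]%classic by exact: emeasurable_itv.
  apply/seteqP; split => x /=; rewrite in_itv /= leey andbT.
    exact: ereal_inf_lbound.
  by move=> /Uup; apply.
suff -> : U = `]ereal_inf U, +oo]%classic by exact: emeasurable_itv.
apply/seteqP; split => x /=; rewrite in_itv /= leey andbT.
  move=> Ux; rewrite lt_neqAle ereal_inf_lbound// andbT.
  by apply/eqP => E; apply: Um; rewrite E.
by move=> /ereal_inf_lt[y Uy /ltW yx]; apply: Uup Uy.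
Qed.

Lemma measurable_state_space (R : realType) (l r : \bar R) :
  measurable (state_space l r).
Proof.
rewrite [X in measurable X](_ : _ = `[l, r]%classic).
  exact: emeasurable_itv.
by apply/seteqP; split => x; rewrite /= in_itv.
Qed.

Section events.
Context d (Omega : measurableType d) (R : realType) (X : R -> Omega -> \bar R).
Implicit Types (u v p q t : R) (a b y z : \bar R).
Hypothesis cX :
  forall w, {within [set u : R | (0 <= u)%R], continuous (X ^~ w)}.

Definition visit p q a : set Omega :=
  [set w | exists2 u, (p < u <= q)%R & X u w = a].

Definition visit_after p a : set Omega :=
  [set w | exists2 u, (p < u)%R & X u w = a].

(** Time t itself is excluded, so that paths that are at a at time t are only
    required not to return to a. *)
Definition first_hit t a b : set Omega :=
  [set w | exists v, [/\ (t < v)%R, X v w = b &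
     forall u, (t < u)%R -> (u <= v)%R -> X u w <> a]].

Lemma measurable_contract_ball a (e : R) :
  measurable [set x : \bar R | (`|contract x - contract a| < e)%R].
Proof.
rewrite [X in measurable X](_ : _ =
    [set x | contract a - e < contract x]%R `&`
    ~` [set x | contract a + e <= contract x]%R).
  apply: measurableI; last apply: measurableC; apply: measurable_upper => x y.
    by rewrite -le_contract => xy /= /lt_le_trans; apply.
  by rewrite -le_contract => xy /= /le_trans; apply.
apply/seteqP; split => x /=; rewrite ltr_distl.
  by move=> /andP[h1 h2]; split => //; apply/negP; rewrite -ltNge.
by move=> [-> /negP]; rewrite -ltNge => ->.
Qed.

Lemma measurable_visit_cc p q a : (0 <= p)%R -> (p <= q)%R ->
  (forall u, (p <= u <= q)%R -> measurable_fun setT (X u)) ->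
  measurable [set w | exists2 u, (p <= u <= q)%R & X u w = a].
Proof.
move=> p0 pq mX; pose S (n : nat) (k : rat) := [set w | (0 <= (ratr k : R) <= 1)%R /\
  (`|contract (X (p + (q - p) * ratr k)%R w) - contract a| < n.+1%:R^-1)%R].
rewrite [X in measurable X](_ : _ = \bigcap_n \bigcup_k S n k).
  apply: bigcapT_measurable => n; apply: bigcupT_measurable_rat => k.
  rewrite /S; have [k01|k01] := boolP (0 <= (ratr k : R) <= 1)%R; last first.
    rewrite [X in measurable X](_ : _ = set0)//.
    by apply/seteqP; split => // w [].
  rewrite [X in measurable X](_ : _ = setT `&` X (p + (q - p) * ratr k)%R @^-1`
    [set x : \bar R | (`|contract x - contract a| < n.+1%:R^-1)%R]).
    apply: mX => //; last exact: measurable_contract_ball.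
    case/andP: k01 => k0 k1; rewrite lerDl mulr_ge0 ?subr_ge0//=.
    by rewrite -lerBrDl ler_piMr// subr_ge0.
  by apply/seteqP; split => w //= [].
apply/seteqP; split => w.
  by move=> /(visit_approx (@cX w) a p0 pq) H n _; have [k k1 k2] := H n; exists k.
move=> H; apply/(visit_approx (@cX w) a p0 pq) => n.
by have [k _ [k1 k2]] := H n I; exists k.
Qed.

Lemma measurable_visit p q a : (0 <= p)%R ->
  (forall u, (p <= u <= q)%R -> measurable_fun setT (X u)) ->
  measurable (visit p q a).
Proof.
move=> p0 mX; have [pq|qp] := ltP p q; last first.
  rewrite [X in measurable X](_ : _ = set0)//; apply/seteqP; split => // w.
  by move=> [u /andP[pu /(lt_le_trans pu)]]; rewrite ltNge qp.
pose c n := (p + (q - p) / n.+1%:R)%R.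
have cp n : (p < c n)%R by rewrite ltrDl divr_gt0// subr_gt0.
have cq n : (c n <= q)%R.
  rewrite -lerBrDl ler_pdivrMr// ler_peMr ?subr_ge0 ?(ltW pq)//.
  by rewrite (ler_nat _ 1).
rewrite [X in measurable X](_ : _ =
    \bigcup_n [set w | exists2 u, (c n <= u <= q)%R & X u w = a]).
  apply: bigcupT_measurable => n; apply: measurable_visit_cc => //.
    by rewrite (le_trans p0)// ltW.
  by move=> u /andP[cu uq]; apply: mX; rewrite uq andbT (le_trans (ltW (cp n))).
apply/seteqP; split => w; last first.
  move=> [n _ [u /andP[cu uq] Xu]]; exists u => //.
  by rewrite uq andbT (lt_le_trans (cp n)).
move=> [u /andP[pu uq] Xu].
have h : (0 < (u - p) / (q - p))%R by rewrite divr_gt0// subr_gt0.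
have [n hn] := ltr_add_invr h; rewrite add0r in hn.
exists n => //; exists u => //; rewrite uq andbT /c -lerBrDl.
by move: hn => /ltW; rewrite ler_pdivlMr ?subr_gt0// mulrC.
Qed.

Lemma measurable_visit_after p a : (0 <= p)%R ->
  (forall u, (p <= u)%R -> measurable_fun setT (X u)) ->
  measurable (visit_after p a).
Proof.
move=> p0 mX; rewrite [X in measurable X](_ : _ = \bigcup_n visit p n%:R a).
  apply: bigcupT_measurable => n; apply: measurable_visit => // u.
  by move=> /andP[/mX].
apply/seteqP; split => w.
  move=> [u pu Xu]; exists (Num.bound u) => //; exists u => //.
  by rewrite pu ltW// archi_boundP// (le_trans p0)// ltW.
by move=> [n _ [u /andP[pu _] Xu]]; exists u.
Qed.

(** Just after a visit to b the path is still away from a, so that the time of the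
    visit to b can be replaced by a rational one. *)
Lemma measurable_first_hit t a b : (0 <= t)%R -> a <> b ->
  (forall u, (t <= u)%R -> measurable_fun setT (X u)) ->
  measurable (first_hit t a b).
Proof.
move=> t0 ab mX; rewrite [X in measurable X](_ : _ =
   \bigcup_(k : rat) (visit t (ratr k) b `\` visit t (ratr k) a)).
  apply: bigcupT_measurable_rat => k; apply: measurableD;
  by apply: measurable_visit => // u /andP[/mX].
apply/seteqP; split => w.
  move=> [v [tv Xv nv]]; have v0 : (0 <= v)%R by rewrite (le_trans t0)// ltW.
  have /(path_ne (@cX w) v0)[e e0 he] : X v w <> a by rewrite Xv => /esym.
  have : (v < v + e)%R by rewrite ltrDl.
  move=> /rat_in_itvoo[k]; rewrite in_itv /= => /andP[vk ke].
  exists k => //; split; first by exists v; rewrite ?tv// ltW.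
  move=> [u /andP[tu uk] Xu]; have [uv|vu] := leP u v; first exact: (nv u).
  apply: (he u) => //; first by rewrite (le_trans t0)// ltW.
  by rewrite gtr0_norm ?subr_gt0// ltrBlDl (le_lt_trans uk).
move=> [k _ [[v /andP[tv vk] Xv] nv]]; exists v; split => // u tu uv Xu.
by apply: nv; exists u => //; rewrite tu (le_trans uv).
Qed.

End events.

(** * Monotone approximation of a point of the extended real line *)

(** The map contract embeds the extended line in [-1, 1], where the sequence can
    be written down uniformly for finite and infinite r. *)
Lemma approach_sup (R : realType) (x r : \bar R) : x < r ->
  exists c : nat -> \bar R, [/\ forall n, x < c n < r,
    {homo c : n m / (n <= m)%N >-> n <= m} &
    forall b, b < r -> exists n, b < c n].
Proof.
move=> xr; pose D := (contract r - contract x)%R.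
have D0 : (0 < D)%R by rewrite subr_gt0 lt_contract.
(* the first term, with n.+2, has to be strictly above x already *)
pose e n := (contract r - D / n.+2%:R)%R.
have eb n : (contract x < e n < contract r)%R.
  rewrite ltrBrDl -ltrBrDr -/D ltr_pdivrMr// ltr_pMr// ltr1n /=.
  by rewrite ltrBlDr ltrDl divr_gt0.
have en n : (`|e n| <= 1)%R.
  have /andP[h1 h2] := eb n; rewrite ler_norml.
  have := contract_le1 x; have := contract_le1 r; rewrite !ler_norml.
  by move=> /andP[_ r1] /andP[x1 _]; rewrite (le_trans x1 (ltW h1)) (le_trans (ltW h2)).
have eK n : contract (expand (e n)) = e n by apply: expandK; rewrite inE.
exists (fun n => expand (e n)); split.
- by move=> n; rewrite -!lt_contract eK.
- move=> n m nm; rewrite -le_contract !eK lerD2l lerN2 ler_pM2l//.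
  by rewrite lef_pV2 ?posrE// ler_nat.
- move=> b br; have h : (0 < (contract r - contract b) / D)%R.
    by rewrite divr_gt0// subr_gt0 lt_contract.
  have [n hn] := ltr_add_invr h; rewrite add0r in hn.
  exists n; rewrite -lt_contract eK ltrBrDl -ltrBrDr.
  apply: (@le_lt_trans _ _ (D / n.+1%:R)%R).
    by rewrite ler_pM2l// lef_pV2 ?posrE// ler_nat.
  by move: hn; rewrite ltr_pdivlMr// mulrC.
Qed.

Lemma approach_cvg (R : realType) (x r : \bar R) (c : nat -> \bar R) :
  (forall n, x < c n < r) -> {homo c : n m / (n <= m)%N >-> n <= m} ->
  (forall b, b < r -> exists n, b < c n) -> c n @[n --> \oo] --> r.
Proof.
move=> cb cm cr V; have xr : x < r by have /andP[/lt_trans] := cb 0%N; apply.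
move=> /(nbhs_left_end xr)[b /cr[n bn] bV]; exists n => // m /= nm.
apply: bV; first exact: lt_le_trans bn (cm _ _ nm).
by have /andP[_ /ltW] := cb m.
Qed.

Lemma approach_inf (R : realType) (l x : \bar R) : l < x ->
  exists a : nat -> \bar R, [/\ forall n, l < a n < x,
    {homo a : n m / (n <= m)%N >-> m <= n},
    forall b, l < b -> exists n, a n < b & a n @[n --> \oo] --> l].
Proof.
move=> lx; have xl : - x < - l by rewrite lteN2.
have [c [cb cm cr]] := approach_sup xl.
exists (fun n => - c n); split.
- by move=> n; have /andP[h1 h2] := cb n; rewrite lteNr h2 lteNl h1.
- by move=> n m nm; rewrite leeN2 cm.
- by move=> b lb; have [|n hn] := cr (- b); [rewrite lteN2 | exists n; rewrite lteNl].
- by rewrite -(oppeK l); apply: cvgeN; exact: approach_cvg cb cm cr.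
Qed.

(** * Limits at infinity and their measurability *)

(** The limit superior at infinity, in continuous time. *)
Definition path_limsup (R : realType) (f : R -> \bar R) : \bar R :=
  ereal_inf [set ereal_sup [set f u | u in [set u : R | (n%:R <= u)%R]]
            | n in [set: nat]].

Lemma path_limsup_lt (R : realType) (f : R -> \bar R) (c : \bar R) :
  path_limsup f < c -> exists n : nat, forall u, (n%:R <= u)%R -> f u < c.
Proof.
move=> /ereal_inf_lt[_ [n _ <-] nc]; exists n => u nu.
by apply: le_lt_trans nc; apply: ereal_sup_ubound; exists u.
Qed.

Lemma path_limsup_cvg (R : realType) (f : R -> \bar R) (v : \bar R) :
  f u @[u --> +oo%R] --> v -> path_limsup f = v.
Proof.
move=> fv; apply/eqP; rewrite eq_le; apply/andP; split; rewrite leNgt; apply/negP.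
- move=> /[dup] /approach_sup[c [cb _ _]] _.
  have /andP[vc cL] := cb 0%N.
  have [M [Mr MP]] := fv _ (open_ereal_lt' vc).
  have : path_limsup f <= c 0%N; last by rewrite leNgt cL.
  apply: ge_ereal_inf; exists (ereal_sup [set f u |
    u in [set u : R | ((Num.bound `|M|%R)%:R <= u)%R]]); first by eexists.
  apply: ge_ereal_sup => _ [u /= nu <-]; apply/ltW/MP; apply: lt_le_trans nu.
  by apply: le_lt_trans (ler_norm M) _; apply: archi_boundP.
- move=> /ereal_inf_lt[_ [n _ <-] nv].
  have [M [Mr MP]] := fv _ (open_ereal_gt' nv).
  have := MP (Num.max (M + 1) n%:R)%R; rewrite lt_max ltrDl ltr01 => /(_ isT).
  rewrite /= ltNge => /negP; apply; apply: ereal_sup_ubound.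
  by exists (Num.max (M + 1) n%:R)%R => //=; rewrite le_max lexx orbT.
Qed.

Lemma nbhs_right_end (R : realType) (v r : \bar R) (V : set (\bar R)) :
  v < r -> nbhs v V -> exists2 c, v < c & forall x, v <= x -> x < c -> V x.
Proof.
move=> vr vV; have [] := @nbhs_left_end _ (- r) (- v) (-%E @` V).
- by rewrite lteNl oppeK.
- by rewrite nbhsNe; exists V.
move=> c cv cV; exists (- c); first by rewrite lteNr.
move=> x vx xc; have [||y Vy /oppe_inj <-//] := cV (- x).
  by rewrite lteNr.
by rewrite leeN2.
Qed.

Section cvg_at_infinity.
Context (R : realType) (l r : \bar R) (f : R -> \bar R).
Hypothesis fs : forall u : R, (0 <= u)%R -> l <= f u <= r.

Lemma path_limsup_itv : l <= path_limsup f <= r.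
Proof.
apply/andP; split.
  apply: le_ereal_inf_tmp => _ [n _ <-]; apply: le_ereal_sup_tmp.
  exists (f n%:R); first by exists n%:R => /=.
  by have /andP[] := fs (ler0n R n).
apply: ge_ereal_inf; exists (ereal_sup [set f u | u in [set u : R | (0%:R <= u)%R]]).
  by exists 0%N.
by apply: ge_ereal_sup => _ [u /= u0 <-]; have /andP[] := fs u0.
Qed.

Lemma path_cvgP v : l <= v <= r ->
  f u @[u --> +oo%R] --> v <->
  path_limsup f = v /\ path_limsup (fun u => - f u) = - v.
Proof.
move=> /andP[lv vr]; split.
  move=> fv; split; first exact: path_limsup_cvg.
  by apply: path_limsup_cvg; apply: cvgeN.
move=> [Lv LNv] V Vv.
have [n1 hn1] : exists n : nat, forall u, (n%:R <= u)%R -> v <= f u -> V (f u).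
  move: vr; rewrite le_eqVlt => /predU1P[vr|vr].
    exists 0%N => u u0 vu.
    suff -> : f u = v by exact: nbhs_singleton.
    by apply/eqP; rewrite eq_le vu vr andbT; have /andP[] := fs u0.
  have [c vc cV] := nbhs_right_end vr Vv; rewrite -Lv in vc.
  have [n hn] := path_limsup_lt vc; exists n => u nu vu.
  by apply: cV => //; exact: hn.
have [n2 hn2] : exists n : nat, forall u, (n%:R <= u)%R -> f u <= v -> V (f u).
  move: lv; rewrite le_eqVlt => /predU1P[lv|lv].
    exists 0%N => u u0 vu.
    suff -> : f u = v by exact: nbhs_singleton.
    by apply/eqP; rewrite eq_le vu -lv /=; have /andP[] := fs u0.
  have [c vc cV] := nbhs_left_end lv Vv.
  rewrite -lteN2 -LNv in vc.
  have [n hn] := path_limsup_lt vc; exists n => u nu vu.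
  by apply: cV => //; rewrite -lteN2; exact: hn.
exists (Num.max n1%:R n2%:R)%R; split; first exact: num_real.
move=> u; rewrite gt_max => /andP[/ltW h1 /ltW h2].
by have [/(hn1 _ h1)|/ltW/(hn2 _ h2)] := leP v (f u).
Qed.

End cvg_at_infinity.

(** By continuity, suprema over times are suprema over rational times. *)
Lemma measurable_path_limsup d (Omega : measurableType d) (R : realType)
    (X : R -> Omega -> \bar R) :
  (forall w, {within [set u : R | (0 <= u)%R], continuous (X ^~ w)}) ->
  (forall u, (0 <= u)%R -> measurable_fun setT (X u)) ->
  measurable_fun setT (fun w => path_limsup (X ^~ w)).
Proof.
move=> cX mX; pose M n w := ereal_sup [set X u w | u in [set u : R | (n%:R <= u)%R]].
have mM n : measurable_fun setT (M n).
  apply: (measurability _ (ErealGenOInfty.measurableE R)).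
  move=> _ [_ [c ->] <-]; rewrite setTI.
  rewrite [X in measurable X](_ : _ = \bigcup_(k : rat)
      (if (n%:R <= ratr k :> R)%R then X (ratr k) @^-1` `]c%:E, +oo]%classic else set0)).
    apply: bigcupT_measurable_rat => k; case: ifPn => // nk.
    rewrite -[X in measurable X]setTI; apply: mX => //.
      exact: le_trans nk.
    exact: emeasurable_itv.
  apply/seteqP; split => w /=; rewrite ?in_itv /= ?andbT.
    move=> /ereal_sup_gt[_ [u /= nu <-] cu].
    have u0 : (0 <= u)%R by exact: le_trans nu.
    have [e e0 he] := path_gt (@cX w) u0 cu.
    have : (u < u + e)%R by rewrite ltrDl.
    move=> /rat_in_itvoo[k]; rewrite in_itv /= => /andP[uk ke].
    exists k => //; rewrite (le_trans nu (ltW uk)) /= in_itv /= leey andbT.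
    apply: he; first by rewrite (le_trans u0)// ltW.
    by rewrite gtr0_norm ?subr_gt0// ltrBlDl.
  move=> [k _]; case: ifPn => // nk; rewrite /= in_itv /= leey andbT => ck.
  by apply: lt_le_trans ck _; apply: ereal_sup_ubound; exists (ratr k).
apply: (measurability _ (ErealGenInftyO.measurableE R)).
move=> _ [_ [c ->] <-]; rewrite setTI.
rewrite [X in measurable X](_ : _ = \bigcup_n (M n @^-1` `]-oo, c%:E[%classic)).
  apply: bigcupT_measurable => n.
  rewrite -[X in measurable X]setTI; apply: mM => //; exact: emeasurable_itv.
apply/seteqP; split => w /=; rewrite in_itv /=.
  by move=> /ereal_inf_lt[_ [n _ <-] nc]; exists n => //=; rewrite in_itv.
move=> [n _] /=; rewrite in_itv /=; apply: le_lt_trans.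
by apply: ereal_inf_lbound; exists n.
Qed.

(** * Measurability of hitting times and terminal values *)

Section terminal_measurability.
Context d (Omega : measurableType d) (R : realType) (l r : \bar R).
Variable X : R -> Omega -> \bar R.
Implicit Types (u v p q t : R) (a b y z : \bar R).
Hypothesis hlr : l < r.
Hypothesis sX : forall w u, (0 <= u)%R -> l <= X u w <= r.
Hypothesis cX :
  forall w, {within [set u : R | (0 <= u)%R], continuous (X ^~ w)}.
Hypothesis aX : forall w u v, (0 <= u <= v)%R ->
  X u w = l \/ X u w = r -> X v w = X u w.
Hypothesis mX : forall u, (0 <= u)%R -> measurable_fun setT (X u).

Lemma measurable_hitting_time z :
  measurable_fun setT (hitting_time l r X z).
Proof.
apply: (measurability _ (ErealGenInftyO.measurableE R)).
move=> _ [_ [c ->] <-]; rewrite setTI.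
pose V a := \bigcup_(k in [set k : rat | (ratr k < c)%R]) visit X 0 (ratr k) a.
have mV a : measurable (V a).
  rewrite /V bigcup_mkcond; apply: bigcupT_measurable_rat => k; case: ifPn => // _.
  by apply: measurable_visit => // u /andP[u0 _]; exact: mX.
have VP a w : V a w <-> exists u, [/\ (0 < u)%R, u%:E < c%:E & X u w = a].
  split=> [[k /= kc [u /andP[u0 uk] Xu]]|[u [u0]]].
    by exists u; rewrite lte_fin (le_lt_trans uk kc).
  rewrite lte_fin => /rat_in_itvoo[k]; rewrite in_itv /= => /andP[uk kc] Xu.
  by exists k => //; exists u => //; rewrite u0 ltW.
rewrite [X in measurable X](_ : _ =
    V z `|` (~` visit_after X 0 z `&` (V l `|` V r))).
  apply: measurableU => //; apply: measurableI; last exact: measurableU.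
  apply: measurableC; exact: measurable_visit_after.
apply/seteqP; split => w /=; rewrite in_itv /= /hitting_time.
- case: pselect => [vis|novis] /=.
    by move=> /ereal_inf_lt[_ [u [u0 Xu] <-] uc]; left; apply/VP; exists u.
  move=> /ereal_inf_lt[_ [u [u0 Xu] <-] uc]; right; split.
    by move=> [v v0 Xv]; apply: novis; exists v.
  by case: Xu => Xu; [left | right]; apply/VP; exists u.
- move=> [/VP[u [u0 uc Xu]]|[nv H]]; case: pselect => [vis|novis] /=.
  + by apply: le_lt_trans uc; apply: ereal_inf_lbound; exists u.
  + by exfalso; apply: novis; exists u.
  + by exfalso; case: vis => u [u0 Xu]; apply: nv; exists u.
  + case: H => /VP[u [u0 uc Xu]]; apply: le_lt_trans uc;
    apply: ereal_inf_lbound; exists u => //; split => //; [by left|by right].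
Qed.

Lemma measurable_last_passage_le y z t : (0 <= t)%R ->
  measurable [set w | last_passage l r X y z w <= t%:E].
Proof.
move=> t0; rewrite [X in measurable X](_ : _ = ~` \bigcup_(k : rat)
    (visit X t (ratr k) y `&` [set w | (ratr k)%:E < hitting_time l r X z w])).
  apply: measurableC; apply: bigcupT_measurable_rat => k; apply: measurableI.
    apply: measurable_visit => // u /andP[tu _]; apply: mX; exact: le_trans tu.
  rewrite -[X in measurable X]setTI; apply: emeasurable_fun_o_infty => //.
  exact: measurable_hitting_time.
apply/seteqP; split => w /=.
  move=> /(last_passage_le l r X w y z t0) H [k _ [[u /andP[tu uk] Xu] kT]].
  by apply: (H u) => //; apply: le_lt_trans kT; rewrite lee_fin.
move=> H; apply/(last_passage_le l r X w y z t0) => u tu uT Xu; apply: H.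
have [q uq qT] : exists2 q : R, (u < q)%R & q%:E <= hitting_time l r X z w.
  move: uT; case: (hitting_time l r X z w) => [q||//].
    by rewrite lte_fin => uq; exists q.
  by move=> _; exists (u + 1)%R; rewrite ?ltrDl// leey.
have [k] := rat_in_itvoo uq; rewrite in_itv /= => /andP[uk kq].
exists k => //; split; first by exists u => //; rewrite tu ltW.
by apply: lt_le_trans qT; rewrite lte_fin.
Qed.

Lemma measurable_alive0 : measurable [set w | l < X 0%R w < r].
Proof.
rewrite [X in measurable X](_ : _ = setT `&` X 0%R @^-1` `]l, r[%classic).
  by apply: mX => //; exact: emeasurable_itv.
by apply/seteqP; split => w; rewrite /= in_itv /= => // -[].
Qed.

Let limsup_event z := [set w | path_limsup (X ^~ w) = z] `&`
  [set w | path_limsup (fun u => - X u w) = - z].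

Let mlimsup := measurable_path_limsup cX mX.

Let mliminf : measurable_fun setT (fun w => path_limsup (fun u => - X u w)).
Proof.
apply: (@measurable_path_limsup _ _ _ (fun u w => - X u w)).
  move=> w u; apply: cvgeN; exact: cX.
by move=> u u0; apply: measurableT_comp (mX u0); exact: oppe_measurable.
Qed.

Lemma left_limit_isP z w : l <= z <= r -> l < X 0%R w < r ->
  left_limit_is l r X z w <->
  path_limsup (X ^~ w) = z /\ path_limsup (fun u => - X u w) = - z.
Proof.
move=> hz w0; rewrite -(path_cvgP (@sX w) hz) /left_limit_is /=.
apply: (left_limit_cvg (@sX w) (@cX w) (@aX w)).
exact: (lifetime_alive0 (@cX w) (@aX w)).
Qed.

Lemma measurable_left_limit_is z : l <= z <= r ->
  measurable (left_limit_is l r X z).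
Proof.
move=> hz.
rewrite [X in measurable X](_ : _ = ~` [set w | l < X 0%R w < r] `|`
   ([set w | l < X 0%R w < r] `&` limsup_event z)).
  apply: measurableU; first by apply: measurableC; exact: measurable_alive0.
  apply: measurableI; first exact: measurable_alive0.
  apply: measurableI; rewrite -[X in measurable X]setTI.
    exact: (mlimsup measurableT (emeasurable_set1 z)).
  exact: (mliminf measurableT (emeasurable_set1 (- z))).
apply/seteqP; split => w.
  have [w0 H|w0 _] := pselect (l < X 0%R w < r); last by left.
  by right; split => //; apply/(left_limit_isP hz w0).
move=> [w0|[w0 H]]; last exact/(left_limit_isP hz w0).
rewrite /left_limit_is /= /before_lifetime (lifetime_dead0 (@sX w) (@aX w)) //.
move=> V _; suff : \forall e \near (0 : \bar R), 0 <= e < 0 -> V (X (fine e) w) by [].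
by apply: filterE => e /andP[/le_lt_trans h /h]; rewrite ltxx.
Qed.

Lemma measurable_hits_before z b : l <= z <= r -> b = l \/ b = r ->
  measurable (hits_before l r X z b).
Proof.
move=> hz hb; have [zb|zi] := pselect (z = l \/ z = r).
  rewrite [X in measurable X](_ : _ = left_limit_is l r X z).
    exact: measurable_left_limit_is.
  by apply/seteqP; split => w; rewrite (hits_before_boundary X w b zb).
have zl : z != l by apply/eqP => E; apply: zi; left.
have zr : z != r by apply/eqP => E; apply: zi; right.
rewrite /hits_before (negbTE zl) (negbTE zr) /=.
rewrite -[X in measurable X]setTI; apply: measurable_lte => //;
  exact: measurable_hitting_time.
Qed.

(** A formula valid for all paths, including those for which the left limit is
    only a conventional value: it is then one of two constants, according to
    whether the path starts at the boundary, where the filter of left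
    neighbourhoods of the lifetime is trivial, or has no limit. *)
Lemma left_limitE w : left_limit l r X w =
  if l < X 0%R w < r then
    if path_limsup (X ^~ w) == - path_limsup (fun u => - X u w)
    then path_limsup (X ^~ w) else point
  else lim [set: set (\bar R)].
Proof.
case: ifPn => w0; last first.
  rewrite /left_limit /before_lifetime (lifetime_dead0 (@sX w) (@aX w)); last exact/negP.
  congr lim; apply/seteqP; split => // V _.
  suff : \forall e \near (0 : \bar R), 0 <= e < 0 -> V (X (fine e) w) by [].
  by apply: filterE => e /andP[/le_lt_trans h /h]; rewrite ltxx.
have z0 : 0 < lifetime l r X w by exact: (lifetime_alive0 (@cX w) (@aX w)).
case: eqP => E.
  apply: left_limit_value => //; apply/left_limit_isP => //.
    exact: path_limsup_itv (@sX w).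
  by split => //; rewrite E oppeK.
apply: dvgP => /cvg_ex[v H]; apply: E.
have Hv : X u w @[u --> +oo%R] --> v.
  by apply/(left_limit_cvg (@sX w) (@cX w) (@aX w) v z0).
by rewrite (path_limsup_cvg Hv) (path_limsup_cvg (cvgeN Hv)) oppeK.
Qed.

(** Off the lifetime, the hitting time of z is attained since paths are continuous. *)
Lemma stopped_valueE z w : stopped_value l r X z w =
  if hitting_time l r X z w == hitting_time l r X l w
  then left_limit l r X w else z.
Proof.
rewrite (hitting_time_boundary hlr (@cX w) (@aX w) (or_introl erefl)).
rewrite /stopped_value; case: ifPn => //.
have := hitting_time_ge0 l r X w z.
rewrite /hitting_time; case: pselect => [[q [q0 Xq]]|novis] /=; last first.
  by rewrite eqxx.
set I := ereal_inf _ => I0 _.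
have Iq : I <= q%:E by apply: ereal_inf_lbound; exists q.
have If : I \is a fin_num.
  by rewrite ge0_fin_numE//; apply: le_lt_trans Iq _; rewrite ltry.
have f0 : (0 <= fine I)%R by exact: fine_ge0.
apply: contrapT => /(path_ne (@cX w) f0)[e e0 he].
have [_ [v [v0 Xv] <-] vI] := lb_ereal_inf_adherent e0 If.
apply: (he v) => //; first exact: ltW.
have Iv : I <= v%:E by apply: ereal_inf_lbound; exists v.
rewrite -/I -(fineK If) -EFinD lte_fin in vI.
rewrite -(fineK If) lee_fin in Iv.
by rewrite ger0_norm ?subr_ge0// ltrBlDl.
Qed.

Lemma measurable_stopped_value z (phi : \bar R -> \bar R) :
  measurable_fun (state_space l r) phi ->
  measurable_fun setT (fun w => phi (stopped_value l r X z w)).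
Proof.
move=> mphi; have mS := measurable_state_space l r.
rewrite (_ : (fun w => _) = (fun w =>
  if hitting_time l r X z w == hitting_time l r X l w then
    if l < X 0%R w < r then
      if path_limsup (X ^~ w) == - path_limsup (fun u => - X u w)
      then phi (path_limsup (X ^~ w)) else phi point
    else phi (lim [set: set (\bar R)])
  else phi z)); last first.
  apply/funext => w; rewrite stopped_valueE left_limitE.
  case: (hitting_time l r X z w == _) => //.
  by case: (l < X 0%R w < r) => //; case: (path_limsup (X ^~ w) == _).
apply: measurable_fun_ifT => //.
  by apply: measurable_fun_eqe; exact: measurable_hitting_time.
apply: measurable_fun_ifT => //.
  apply: (measurable_fun_bool true); rewrite setTI; exact: measurable_alive0.
apply: measurable_fun_ifT => //.
  by apply: measurable_fun_eqe => //; apply: measurableT_comp mliminf; exact: oppe_measurable.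
apply: (measurable_comp mS) => // x [w _ <-]; exact: path_limsup_itv (@sX w).
Qed.

End terminal_measurability.

(** * Natural filtration, stopping times and the strong Markov property *)

Section diffusion.
Context (R : realType) (d : measure_display) (Omega : measurableType d).
Context (l r : \bar R) (X : R -> Omega -> \bar R) (theta : R -> Omega -> Omega).
Context (P : \bar R -> probability Omega R).
Implicit Types (u v t : R) (a b x y z : \bar R) (w : Omega).
Hypothesis hlr : l < r.
Hypothesis hX : regular_diffusion l r X P theta.

Lemma diffusion_itv w u : (0 <= u)%R -> l <= X u w <= r.
Proof. exact: (diffusion_state hX). Qed.

Lemma diffusion_cont w :
  {within [set u : R | (0 <= u)%R], continuous (X ^~ w)}.
Proof. exact: (diffusion_continuous hX). Qed.

Lemma diffusion_absorb w u v : (0 <= u <= v)%R ->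
  X u w = l \/ X u w = r -> X v w = X u w.
Proof. by move=> uv; apply: (diffusion_absorbing hX). Qed.

Let sX := diffusion_itv.
Let cX := diffusion_cont.
Let aX := diffusion_absorb.

(** The generators of the natural sigma-algebra, named so that this sigma-algebra
    can be made the one of a measurable type on Omega. *)
Definition natural_gen (J : set R) : set_system Omega :=
  [set A | exists (u : R) (B : set \bar R),
    [/\ (0 <= u)%R, J u, measurable B & A = X u @^-1` B]].

Local Notation natural J := (g_sigma_algebraType (natural_gen J)).

Lemma natural_measurableX (J : set R) u : (0 <= u)%R -> J u ->
  measurable_fun [set: natural J] (X u : natural J -> \bar R).
Proof.
move=> u0 Ju _ B mB; rewrite setTI; apply: sub_sigma_algebra.
by exists u, B.
Qed.

Lemma natural_sigmaS (J K : set R) : J `<=` K ->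
  natural_sigma X J `<=` natural_sigma X K.
Proof.
move=> JK; apply: sub_sigma_algebra2 => A [u [B [u0 Ju mB ->]]].
by exists u, B; split => //; exact: JK.
Qed.

Lemma sub_universal_completion (G : set_system Omega) :
  G `<=` universal_completion l r X P G.
Proof.
move=> A GA mu _; exists A, set0; split => //.
- exact: sigma_algebra0.
- by rewrite /initial_law; under eq_integral do rewrite measure0; rewrite integral0.
- by rewrite setDv setU0.
Qed.

Lemma universal_completionS (G G' : set_system Omega) : G `<=` G' ->
  universal_completion l r X P G `<=` universal_completion l r X P G'.
Proof.
move=> GG' A H mu hmu; have [B [N [GB nN N0 AB]]] := H mu hmu.
by exists B, N; split => //; exact: GG'.
Qed.

Lemma natural_measurable (J : set R) A : natural_sigma X J A -> measurable A.
Proof.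
move=> /(natural_sigmaS (@subsetT _ J)) nA; rewrite (diffusion_sigma hX).
exact: sub_universal_completion.
Qed.

Lemma measurableX u : (0 <= u)%R -> measurable_fun setT (X u).
Proof.
move=> u0 _ B mB; rewrite setTI; apply: (natural_measurable (J := setT)).
by apply: sub_sigma_algebra; exists u, B.
Qed.

Lemma natural_filtration t A :
  natural_sigma X [set v | (v <= t)%R] A -> filtration l r X P t A.
Proof.
move=> nA u tu; apply: sub_universal_completion; apply: natural_sigmaS nA.
by move=> v /= /le_trans; apply; exact: ltW.
Qed.

Lemma filtration_measurable t A : filtration l r X P t A -> measurable A.
Proof.
move=> /(_ (t + 1)%R); rewrite ltrDl ltr01 => /(_ isT).
rewrite (diffusion_sigma hX); apply: universal_completionS.
by apply: natural_sigmaS => v.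
Qed.

Lemma filtrationS t u A : (t <= u)%R -> filtration l r X P t A ->
  filtration l r X P u A.
Proof. by move=> tu FA v uv; apply: FA; exact: le_lt_trans uv. Qed.

(** Intersecting both a set and its approximation with the same raw event does
    not enlarge their difference. *)
Lemma filtrationI t A B : filtration l r X P t A ->
  natural_sigma X [set v | (v <= t)%R] B -> filtration l r X P t (A `&` B).
Proof.
move=> FA nB u tu mu hmu; have [C [N [nC nN N0 AC]]] := FA u tu mu hmu.
exists (C `&` B), N; split => //.
  apply: (@measurableI _ (natural [set v | (v <= u)%R])) => //.
  apply: natural_sigmaS nB => v /= /le_trans; apply; exact: ltW.
move=> w [[[Aw Bw] nCB]|[[Cw Bw] nAB]]; apply: AC; [left|right]; split => //.
- by move=> Cw; apply: nCB.
- by move=> Aw; apply: nAB.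
Qed.

Lemma natural_start x t : (0 <= t)%R ->
  natural_sigma X [set v | (v <= t)%R] [set w | X 0%R w = x].
Proof.
move=> t0; apply: sub_sigma_algebra; exists 0%R, [set x]; split => //.
Qed.

Lemma measurable_start x : measurable [set w | X 0%R w = x].
Proof. exact: natural_measurable (natural_start x (lexx 0%R)). Qed.

Lemma prob_start x A : state_space l r x -> measurable A ->
  P x (A `&` [set w | X 0%R w = x]) = P x A.
Proof.
move=> hx mA; have mS := measurable_start x.
have nS : P x (~` [set w | X 0%R w = x]) = 0.
  by rewrite probability_setC ?(diffusion_start hX)// subee.
rewrite [RHS](measureDI _ mA mS).
rewrite [X in _ = X + _](_ : _ = 0) ?add0e//.
apply: subset_measure0 nS; [exact: measurableD|exact: measurableC|].
by move=> w [].
Qed.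

(** Events that agree on the paths started at x are interchangeable under P x;
    path by path arguments may thus assume that X_0 = x. *)
Lemma eq_prob_start x A B : state_space l r x -> measurable A -> measurable B ->
  (forall w, X 0%R w = x -> A w <-> B w) -> P x A = P x B.
Proof.
move=> hx mA mB AB; rewrite -prob_start// -[RHS]prob_start//; congr (P x _).
by apply/seteqP; split => w [Hw Xw]; split => //; apply/AB.
Qed.

Lemma le_prob_start x A B : state_space l r x -> measurable A -> measurable B ->
  (forall w, X 0%R w = x -> A w -> B w) -> P x A <= P x B.
Proof.
move=> hx mA mB AB; rewrite -prob_start// -[leRHS]prob_start//.
apply: le_measure; rewrite ?inE; try (apply: measurableI => //; exact: measurable_start).
by move=> w [Aw Xw]; split => //; exact: AB.
Qed.

Lemma ae_start x : state_space l r x -> \forall w \ae P x, X 0%R w = x.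
Proof.
move=> hx; exists (~` [set w | X 0%R w = x]); split => //.
  by apply: measurableC; exact: measurable_start.
by rewrite probability_setC ?(diffusion_start hX)// ?subee//; exact: measurable_start.
Qed.

(** The first visit to a, with value +oo if b is visited before; for a = b
    this is simply the first visit to a. *)
Definition first_time a b w : \bar R :=
  ereal_inf [set v%:E | v in [set v | [/\ (0 <= v)%R, X v w = a &
    forall u, (0 <= u)%R -> (u < v)%R -> X u w <> b]]].

Lemma first_time_le a b w v : (0 <= v)%R -> X v w = a ->
  (forall u, (0 <= u)%R -> (u < v)%R -> X u w <> b) -> first_time a b w <= v%:E.
Proof. by move=> v0 Xv nb; apply: ereal_inf_lbound; exists v. Qed.

Lemma first_time_ge0 a b w : 0 <= first_time a b w.
Proof. by apply: le_ereal_inf_tmp => _ [v [v0 _ _] <-]; rewrite lee_fin. Qed.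

Lemma first_timeP a b w : first_time a b w < +oo -> exists t,
  [/\ (0 <= t)%R, first_time a b w = t%:E, X t w = a,
    forall u, (0 <= u)%R -> (u < t)%R -> X u w <> a &
    forall u, (0 <= u)%R -> (u < t)%R -> X u w <> b].
Proof.
move=> /ereal_inf_lt[_ [v [v0 Xv nb] <-] _].
have [t [/andP[t0 tv] Xt na]] := first_visit (@cX w) (lexx 0%R) v0 Xv.
have nbt u : (0 <= u)%R -> (u < t)%R -> X u w <> b.
  by move=> u0 ut; apply: nb => //; exact: lt_le_trans tv.
exists t; split => //; apply/eqP; rewrite eq_le first_time_le//=.
apply: le_ereal_inf_tmp => _ [u [u0 Xu _] <-]; rewrite lee_fin leNgt.
by apply/negP => ut; apply: (na u).
Qed.

(** For a <> b, the visit to a takes place by time t iff, for some rational k in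
    [0, 1], the path visits a but not b up to time t * k.  Since t * k never
    exceeds t, the event is in the raw sigma-algebra at time t. *)
Lemma first_time_natural a b t : (0 <= t)%R ->
  natural_sigma X [set v | (v <= t)%R] [set w | first_time a b w <= t%:E].
Proof.
move=> t0.
have mX u : (0 <= u <= t)%R ->
    measurable_fun [set: natural [set v | (v <= t)%R]] (X u : natural _ -> _).
  by move=> /andP[u0 ut]; apply: natural_measurableX.
have cX' (w : natural [set v | (v <= t)%R]) :
  {within [set u : R | (0 <= u)%R], continuous (X ^~ w)} by exact: cX.
pose V q c : set (natural [set v | (v <= t)%R]) :=
  [set w | exists2 u, (0 <= u <= q)%R & X u w = c].
have mV q c : (0 <= q)%R -> (q <= t)%R -> measurable (V q c).
  move=> q0 qt; apply: (@measurable_visit_cc _ (natural _) _ X cX') => // u.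
  by move=> /andP[u0 uq]; apply: mX; rewrite u0 (le_trans uq).
suff : @measurable _ (natural [set v | (v <= t)%R])
    [set w | first_time a b w <= t%:E] by [].
have fin w : first_time a b w <= t%:E -> first_time a b w < +oo.
  by move=> h; apply: le_lt_trans h _; rewrite ltry.
have [ab|/eqP ab] := eqVneq a b.
  subst b; rewrite [X in measurable X](_ : _ = V t a); first exact: mV.
  apply/seteqP; split => w /=.
    move=> h; have [s [s0 E Xs _ _]] := first_timeP (fin w h).
    by exists s => //; rewrite s0 -lee_fin -E.
  move=> [u /andP[u0 ut] Xu].
  have [s [/andP[s0 su] Xs ns]] := first_visit (@cX w) (lexx 0%R) u0 Xu.
  apply: (le_trans (first_time_le s0 Xs ns)).
  by rewrite lee_fin (le_trans su).
rewrite [X in measurable X](_ : _ = \bigcup_(k : rat)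
    (if (0 <= (ratr k : R) <= 1)%R then V (t * ratr k)%R a `\` V (t * ratr k)%R b
     else set0)).
  apply: bigcupT_measurable_rat => k; case: ifPn => // /andP[k0 k1].
  have tk0 : (0 <= t * ratr k)%R by exact: mulr_ge0.
  have tk1 : (t * ratr k <= t)%R by rewrite ler_piMr.
  by apply: measurableD; apply: mV.
apply/seteqP; split => w /=; last first.
  move=> [k _]; case: ifPn => // /andP[k0 k1] [[u /andP[u0 uk] Xu] nb].
  apply: (@le_trans _ _ u%:E).
    apply: first_time_le => // v v0 vu Xv; apply: nb; exists v => //.
    by rewrite v0 (le_trans (ltW vu)).
  by rewrite lee_fin (le_trans uk)// ler_piMr.
move=> h; have [s [s0 E Xs _ nb]] := first_timeP (fin w h).
have st : (s <= t)%R by rewrite -lee_fin -E.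
have [e e0 he] : exists2 e : R, (0 < e)%R &
    forall v, (0 <= v)%R -> (`|v - s| < e)%R -> X v w <> b.
  by apply: (path_ne (@cX w)) => //; rewrite Xs.
(* X stays away from b until s + e, hence up to time t * k *)
have [k k01 /andP[sk ke]] : exists2 k : rat, (0 <= (ratr k : R) <= 1)%R &
    (s <= t * ratr k < s + e)%R.
  move: st; rewrite le_eqVlt => /predU1P[->|st].
    by exists 1%R; rewrite rmorph1 ?ler01 ?lexx// mulr1 lexx ltrDl.
  have t_gt0 : (0 < t)%R by exact: le_lt_trans st.
  have : (s / t < Num.min 1 ((s + e) / t))%R.
    by rewrite lt_min ltr_pdivrMr// mul1r st ltr_pM2r ?invr_gt0// ltrDl.
  move=> /rat_in_itvoo[k]; rewrite in_itv /= lt_min => /and3P[h1 h2 h3].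
  exists k; first by rewrite (ltW h2) andbT (le_trans _ (ltW h1))// divr_ge0// ltW.
  rewrite mulrC; move: h1 h3; rewrite ltr_pdivrMr// ltr_pdivlMr// => h1 ->.
  by rewrite ltW.
exists k => //; rewrite k01; split; first by exists s => //; rewrite s0.
move=> [v /andP[v0 vk] Xv]; have [vs|sv] := ltP v s; first exact: (nb v).
apply: (he v) => //; rewrite ger0_norm ?subr_ge0// ltrBlDl.
exact: le_lt_trans vk ke.
Qed.

Lemma first_time_stopping a b : stopping_time l r X P (first_time a b).
Proof.
split=> [w|t t0]; first exact: first_time_ge0.
by apply: natural_filtration; apply: first_time_natural.
Qed.

Lemma measurable_first_time_fin a b :
  measurable [set w | first_time a b w < +oo].
Proof.
rewrite [X in measurable X](_ : _ =
    \bigcup_n [set w | first_time a b w <= (n%:R)%:E]).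
  apply: bigcupT_measurable => n.
  exact: natural_measurable (first_time_natural a b (ler0n R n)).
apply/seteqP; split => w /=.
  move=> /first_timeP[t [t0 E _ _ _]]; exists (Num.bound t) => //=.
  by rewrite E lee_fin ltW// archi_boundP.
by move=> [n _] /= h; apply: le_lt_trans h _; rewrite ltry.
Qed.

(** The strong Markov property at the first visit to a: what happens afterwards
    is independent of how a was reached.  The event X_0 = x, of full measure, is
    kept on the left so that later no measurability question arises there. *)
Lemma strong_markov_first_time x a b (E : set Omega) : state_space l r x ->
  natural_sigma X setT E ->
  P x ([set w | X 0%R w = x] `&`
       [set w | first_time a b w < +oo /\ E (theta (fine (first_time a b w)) w)])
  = P a E * P x [set w | first_time a b w < +oo].
Proof.
move=> hx nE; rewrite (diffusion_strong_markov hX hx (first_time_stopping a b)) //.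
  have mA : measurable ([set w | X 0%R w = x] `&` [set w | first_time a b w < +oo]).
    by apply: measurableI; [exact: measurable_start|exact: measurable_first_time_fin].
  under eq_integral => w.
    rewrite inE => -[_ /= /first_timeP[t [t0 Et Xt _ _]]].
    rewrite Et /= Xt.
    over.
  rewrite integral_cst//; congr (_ * _); rewrite setIC; apply: prob_start => //.
  exact: measurable_first_time_fin.
split; first exact: measurable_start.
move=> t t0; apply: natural_filtration.
apply: (@measurableI _ (natural [set v | (v <= t)%R])).
  exact: natural_start.
exact: first_time_natural.
Qed.

(** The strong Markov property at a constant time. *)
Lemma markov_property x t A (E : set Omega) : state_space l r x -> (0 <= t)%R ->
  filtration l r X P t A -> natural_sigma X setT E ->
  P x (A `&` [set w | E (theta t w)]) = \int[P x]_(w in A) P (X t w) E.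
Proof.
move=> hx t0 FA nE.
have st : stopping_time l r X P (fun _ => t%:E).
  split=> [w|u u0]; first by rewrite lee_fin.
  apply: natural_filtration; have [tu|tu] := boolP (t%:E <= u%:E).
    rewrite [X in natural_sigma _ _ X](_ : _ = setT).
      exact: (@measurableT _ (natural [set v | (v <= u)%R])).
    by apply/seteqP; split.
  rewrite [X in natural_sigma _ _ X](_ : _ = set0).
    exact: (@measurable0 _ (natural [set v | (v <= u)%R])).
  by apply/seteqP; split => // w /=; rewrite (negbTE tu).
have := diffusion_strong_markov hX hx st (A := A) (E := E) _ nE.
rewrite (_ : [set w : Omega | _ /\ _] = [set w | E (theta t w)]); last first.
  by apply/seteqP; split => w /=; [move=> [] | move=> Ew; rewrite ltry].
rewrite (_ : [set w : Omega | t%:E < +oo] = setT); last first.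
  by apply/seteqP; split => w //= _; rewrite ltry.
rewrite setIT; apply; split; first exact: filtration_measurable FA.
move=> u u0; have [tu|tu] := leP t u.
  rewrite [X in filtration _ _ _ _ _ X](_ : _ = A); first exact: filtrationS FA.
  by apply/seteqP; split => w /=; [move=> [] | move=> Aw; rewrite lee_fin].
rewrite [X in filtration _ _ _ _ _ X](_ : _ = set0).
  apply: natural_filtration; exact: (@measurable0 _ (natural _)).
by apply/seteqP; split => // w [_ /=]; rewrite lee_fin leNgt tu.
Qed.

End diffusion.

(** * Reflection of the state space *)

(** The map x |-> - x exchanges the two boundary points, and with them all the
    statements about hitting from below and from above.  Hence everything is
    proved for z above the starting point and transported. *)

Section reflect_path.
Context (R : realType) (Omega : Type) (l r : \bar R) (X : R -> Omega -> \bar R).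
Local Notation X' := (fun u w => - X u w).

Lemma lifetime_reflect w : lifetime (- r) (- l) X' w = lifetime l r X w.
Proof.
rewrite /lifetime; congr ereal_inf; congr image; apply/seteqP.
split => u /= [u0 h]; split => //.
  by case: h => /oppe_inj ->; [right|left].
by case: h => ->; [right|left].
Qed.

Lemma hitting_set_reflect y w : hitting_set X' y w = hitting_set X (- y) w.
Proof.
by apply/seteqP; split => u [u0 Xu]; split => //; [rewrite -Xu|rewrite Xu]; rewrite oppeK.
Qed.

Lemma hitting_time_reflect y w :
  hitting_time (- r) (- l) X' y w = hitting_time l r X (- y) w.
Proof. by rewrite /hitting_time lifetime_reflect hitting_set_reflect. Qed.

Lemma left_limit_is_reflect z w :
  left_limit_is (- r) (- l) X' z w = left_limit_is l r X (- z) w.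
Proof.
rewrite /left_limit_is /before_lifetime /= lifetime_reflect.
apply/propext; split => [/cvgeN|/cvgeN]; last by rewrite oppeK.
by under eq_fun do rewrite oppeK.
Qed.

Lemma hits_before_reflect z b w :
  hits_before (- r) (- l) X' z b w = hits_before l r X (- z) (- b) w.
Proof.
have E c : (z == - c) = (- z == c) by apply/eqP/eqP => [->|<-]; rewrite oppeK.
rewrite /hits_before !E orbC; case: ifP => _; first exact: left_limit_is_reflect.
by rewrite /= !hitting_time_reflect.
Qed.

Lemma last_passage_reflect y z w :
  last_passage (- r) (- l) X' y z w = last_passage l r X (- y) (- z) w.
Proof.
rewrite /last_passage hitting_time_reflect; congr (maxe _ (ereal_sup _)).
congr image; apply/seteqP.
by split => u [u0 uT Xu]; split => //; [rewrite -Xu|rewrite Xu]; rewrite oppeK.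
Qed.

Lemma natural_sigma_reflect J : natural_sigma X' J = natural_sigma X J.
Proof.
rewrite /natural_sigma; congr (<<s _ >>); apply/seteqP; split => A.
- move=> [u [B [u0 Ju mB ->]]]; exists u, (-%E @^-1` B); split => //.
  by rewrite -[X in measurable X]setTI; exact: oppe_measurable.
- move=> [u [B [u0 Ju mB ->]]]; exists u, (-%E @^-1` B); split => //.
    by rewrite -[X in measurable X]setTI; exact: oppe_measurable.
  by apply/seteqP; split => w /=; rewrite oppeK.
Qed.

Lemma state_space_reflect x : state_space (- r) (- l) x <-> state_space l r (- x).
Proof. by rewrite /state_space /= leeNl leeNr andbC. Qed.

End reflect_path.

Section reflect_filtration.
Context (R : realType) (d : measure_display) (Omega : measurableType d).
Context (l r : \bar R) (X : R -> Omega -> \bar R).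
Context (P : \bar R -> probability Omega R).
Local Notation X' := (fun u w => - X u w).
Local Notation P' := (fun x => P (- x)).
Hypothesis kernel : forall E, natural_sigma X setT E ->
  measurable_fun (state_space l r) (fun x => P x E).

(** An initial law on the reflected state space is the image of one on the
    original state space. *)
Lemma universal_completion_sub_reflect G :
  universal_completion l r X P G `<=` universal_completion (- r) (- l) X' P' G.
Proof.
move=> A H mu hmu.
have mo : measurable_fun setT (-%E : \bar R -> \bar R) by exact: oppe_measurable.
pose o : {mfun (\bar R) >-> (\bar R)} :=
  HB.pack (-%E : \bar R -> \bar R) (isMeasurableFun.Build _ _ _ _ _ mo).
have preS : -%E @^-1` state_space l r = state_space (- r) (- l).
  apply/seteqP; split => x; first by move=> h; apply/state_space_reflect.
  by move/state_space_reflect.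
have mu1 : distribution mu o (state_space l r) = 1 by rewrite -hmu -preS.
have [B [N [GB nN N0 AB]]] := H (distribution mu o) mu1.
exists B, N; split => //; first by rewrite natural_sigma_reflect.
rewrite -N0 /initial_law -preS.
rewrite (@ge0_integral_pushforward _ _ _ _ _ o mo mu) //.
- exact: measurable_state_space.
- exact: kernel.
Qed.

End reflect_filtration.

Section reflect_diffusion.
Context (R : realType) (d : measure_display) (Omega : measurableType d).
Context (l r : \bar R) (X : R -> Omega -> \bar R) (theta : R -> Omega -> Omega).
Context (P : \bar R -> probability Omega R).
Local Notation X' := (fun u w => - X u w).
Local Notation P' := (fun x => P (- x)).
Hypothesis hX : regular_diffusion l r X P theta.

Lemma kernel_reflect E : natural_sigma X setT E ->
  measurable_fun (state_space (- r) (- l)) (fun x => P (- x) E).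
Proof.
move=> nE; apply: (measurable_comp (measurable_state_space l r) _
  (diffusion_kernel hX nE)).
  by move=> _ [x /state_space_reflect ? <-].
exact: oppe_measurable.
Qed.

Lemma universal_completion_reflect G :
  universal_completion (- r) (- l) X' P' G = universal_completion l r X P G.
Proof.
apply/seteqP; split; last first.
  by apply: universal_completion_sub_reflect => E; exact: (diffusion_kernel hX).
have eX : (fun (u : R) w => - - X u w) = X.
  by apply/funext => u; apply/funext => w; rewrite oppeK.
have eP : (fun x => P (- - x)) = P by apply/funext => x; rewrite oppeK.
have := @universal_completion_sub_reflect _ _ _ (- r) (- l) X' P' _ G.
rewrite !oppeK eX eP.
by apply => E; rewrite natural_sigma_reflect; exact: kernel_reflect.
Qed.

Lemma filtration_reflect : filtration (- r) (- l) X' P' = filtration l r X P.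
Proof.
apply/funext => t; rewrite /filtration; apply/seteqP; split => A H u tu.
  by rewrite -universal_completion_reflect -(natural_sigma_reflect X); exact: H.
by rewrite universal_completion_reflect natural_sigma_reflect; exact: H.
Qed.

Lemma reflect_diffusion : regular_diffusion (- r) (- l) X' P' theta.
Proof.
have sX := diffusion_state hX.
split.
- by rewrite (diffusion_sigma hX) universal_completion_reflect natural_sigma_reflect.
- by move=> u w u0; apply/state_space_reflect; rewrite oppeK; exact: sX.
- by move=> w x; apply: cvgeN; exact: (diffusion_continuous hX).
- move=> u v w uv h; congr (- _); apply: (diffusion_absorbing hX) => //.
  by case: h => /oppe_inj ->; [right|left].
- by move=> u v w u0 v0; rewrite (diffusion_shift hX).
- move=> x /state_space_reflect hx; rewrite -[RHS](diffusion_start hX hx).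
  by congr (P _ _); apply/seteqP; split => w /=; [move=> <-|move=> ->]; rewrite oppeK.
- by move=> E; rewrite natural_sigma_reflect; exact: kernel_reflect.
- move=> x T A E /state_space_reflect hx [T0 sT] [mA sA].
  rewrite natural_sigma_reflect => nE.
  rewrite (diffusion_strong_markov hX hx _ _ nE).
  + by apply: eq_integral => w _; rewrite oppeK.
  + by split => // t t0; rewrite -filtration_reflect; exact: sT.
  + by split => // t t0; rewrite -filtration_reflect; exact: sA.
- move=> x y /andP[rx xl] /andP[ry yl].
  have := diffusion_regular hX (x := - x) (y := - y).
  rewrite lteNr xl lteNl rx lteNr yl lteNl ry => /(_ isT isT).
  congr (0 < P _ _); apply/seteqP; split => w /=;
    by rewrite hitting_time_reflect lifetime_reflect.
Qed.

End reflect_diffusion.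

(** * Two-sided exit probabilities *)

Section exit.
Context (R : realType) (d : measure_display) (Omega : measurableType d).
Context (l r : \bar R) (X : R -> Omega -> \bar R) (theta : R -> Omega -> Omega).
Context (P : \bar R -> probability Omega R) (s : \bar R -> \bar R).
Implicit Types (u v t : R) (a b x y z : \bar R) (w : Omega).
Hypothesis hlr : l < r.
Hypothesis hX : regular_diffusion l r X P theta.
Hypothesis hs : scale_function l r X P s.

Let sX := diffusion_itv hX.
Let cX := diffusion_cont hX.
Let aX := diffusion_absorb hX.

Lemma natural_first_hit a b : a <> b ->
  natural_sigma X setT (first_hit X 0 a b).
Proof.
move=> ab; apply: (@measurable_first_hit _ (g_sigma_algebraType (natural_gen X setT)) _ X) => //.
by move=> u u0; apply: natural_measurableX.
Qed.

Lemma natural_visit_after t a : (0 <= t)%R ->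
  natural_sigma X setT (visit_after X t a).
Proof.
move=> t0; apply: (@measurable_visit_after _ (g_sigma_algebraType (natural_gen X setT)) _ X) => //.
by move=> u u0; apply: natural_measurableX => //; exact: le_trans u0.
Qed.

Lemma measurable_first_hit0 a b : a <> b -> measurable (first_hit X 0 a b).
Proof. by move=> ab; apply: (natural_measurable hX (natural_first_hit ab)). Qed.

Local Notation sigma := (fun x => fine (s x)).

Lemma scale_fineK x : l < x < r -> s x = (sigma x)%:E.
Proof. by move=> hx; rewrite fineK// (scale_fin_num hs). Qed.

Lemma scale_lt a b : l < a -> a < b -> b < r -> (sigma a < sigma b)%R.
Proof.
move=> la ab br; have ha : l < a < r by rewrite la (lt_trans ab).
have hb : l < b < r by rewrite br (lt_trans la).
by rewrite -lte_fin -!scale_fineK//; exact: (scale_increasing hs).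
Qed.

Lemma exit_right a x b : l < a -> a < x -> x < b -> b < r ->
  P x (first_hit X 0 a b) = ((sigma x - sigma a) / (sigma b - sigma a))%:E.
Proof.
move=> la ax xb br; rewrite -(scale_exit hs la ax xb br); congr (P _ _).
have ab := lt_trans ax xb.
have ha : l < a < r by rewrite la (lt_trans ab).
have hb : l < b < r by rewrite br (lt_trans la).
have nab : a <> b by move=> E; rewrite E ltxx in ab.
by apply/seteqP; split => w /(hitting_lt_interior (@cX w) (@aX w) ha hb nab).
Qed.

Lemma no_visit_below a a' w t : a' < a -> a < X 0%R w ->
  (forall u, (0 <= u)%R -> (u < t)%R -> X u w <> a) ->
  forall u, (0 <= u)%R -> (u <= t)%R -> X u w <> a'.
Proof.
move=> a'a a0 na u u0 ut Xu.
have [|v /andP[v0 vu] Xv] := path_IVT (@cX w) (lexx 0%R) u0 (a := a).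
  by rewrite Xu (ltW a0) (ltW a'a) orbT.
apply: (na v v0) => //; apply: lt_le_trans ut.
rewrite lt_neqAle vu andbT; apply/eqP => E.
by move: a'a; rewrite -Xu -E Xv ltxx.
Qed.

(** The scale function gives the probability of exit from ]a, b[ at b only.  To
    go from a' < a to b, the path started at x either exits ]a, b[ at b, or
    exits at a and then exits ]a', b[ at b; solving for the probability of exit
    at a shows that it is the complementary one, so that exit is certain. *)
Lemma exit_left a x b : l < a -> a < x -> x < b -> b < r ->
  P x (first_hit X 0 b a) = ((sigma b - sigma x) / (sigma b - sigma a))%:E.
Proof.
move=> la ax xb br; have ab := lt_trans ax xb.
have [c [+ _ _]] := approach_sup la => /(_ 0%N); set a' := c 0%N => /andP[la' a'a].
have a'x := lt_trans a'a ax; have a'b := lt_trans a'x xb.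
have neq (p q : \bar R) : p < q -> p <> q by move=> pq E; rewrite E ltxx in pq.
have hx : state_space l r x.
  by rewrite /state_space /= (ltW (lt_trans la ax)) (ltW (lt_trans xb br)).
pose D := first_time X a b.
pose S := [set w | X 0%R w = x].
pose U := [set w | D w < +oo /\ first_hit X 0 a' b (theta (fine (D w)) w)].
(* U: after the first visit to a, b is reached before a' *)
have UE : S `&` U = S `&` (first_hit X 0 a' b `\` first_hit X 0 a b).
  apply/seteqP; split => w [Sw].
  - move=> [/(first_timeP hX)[t [t0 Et Xt na nb]]]; rewrite /D Et /=.
    move=> [v [v0 Xv nv]]; split => //; have t_gt0 : (0 < t)%R.
      rewrite lt_neqAle t0 andbT; apply/eqP => E; move: (ax).
      by rewrite -Sw E Xt ltxx.
    rewrite (diffusion_shift hX) ?(ltW v0)// in Xv.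
    split.
      exists (v + t)%R; split => //; first exact: addr_gt0.
      move=> u u0 uv; have [ut|tu] := leP u t.
        by apply: (no_visit_below a'a _ na); rewrite ?Sw// ltW.
      have := nv (u - t)%R; rewrite subr_gt0 tu lerBlDr uv => /(_ isT isT).
      by rewrite (diffusion_shift hX) ?subrK// subr_ge0 ltW.
    move=> [q [q0 Xq nq]]; have [tq|qt] := leP t q.
      exact: (nq t).
    by apply: (nb q) => //; exact: ltW.
  - move=> [[v [v0 Xv nv]] nab]; split => //.
    have [[u /andP[u0 uv] Xu]|nu] := pselect (exists2 u, (0 < u <= v)%R & X u w = a);
      last first.
      exfalso; apply: nab; exists v; split => // u u0 uv Xu.
      by apply: nu; exists u => //; rewrite u0.
    have [t [/andP[t0 tu] Xt na]] := first_visit (@cX w) (lexx 0%R) (ltW u0) Xu.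
    have nb q : (0 <= q)%R -> (q < t)%R -> X q w <> b.
      move=> q0 qt Xq; apply: nab; exists q; split => //.
        rewrite lt_neqAle q0 andbT; apply/eqP => E.
        by move: xb; rewrite -Sw E Xq ltxx.
      by move=> p p0 pq; apply: na; rewrite ?(ltW p0)//; exact: le_lt_trans qt.
    have Dt := first_time_le t0 Xt nb.
    have Dfin : D w < +oo by apply: le_lt_trans Dt _; rewrite ltry.
    split => //; have [t' [t'0 Et' Xt' na' nb']] := first_timeP hX Dfin.
    rewrite /D Et' /=.
    have t'v : (t' < v)%R.
      have t't : (t' <= t)%R by rewrite -lee_fin -Et'.
      rewrite lt_neqAle (le_trans t't (le_trans tu uv)) andbT.
      by apply/eqP => E; move: ab; rewrite -Xt' E Xv ltxx.
    exists (v - t')%R; split; rewrite ?subr_gt0//.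
      by rewrite (diffusion_shift hX) ?subrK// subr_ge0 ltW.
    move=> p p0 pv; rewrite (diffusion_shift hX) ?(ltW p0)//.
    by apply: nv; [exact: ltr_wpDr | rewrite -lerBrDr].
have DE : P x [set w | D w < +oo] = P x (first_hit X 0 b a).
  apply: (eq_prob_start hX hx).
  - exact: measurable_first_time_fin hX _ _.
  - by apply: measurable_first_hit0 => E; move: ab; rewrite E ltxx.
  - move=> w Sw; split.
      move=> /(first_timeP hX)[t [t0 Et Xt na nb]]; exists t; split => //.
        rewrite lt_neqAle t0 andbT; apply/eqP => E; move: (ax).
        by rewrite -Sw E Xt ltxx.
      move=> u u0; rewrite le_eqVlt => /predU1P[->|ut] Xu.
        by move: ab; rewrite -Xt Xu ltxx.
      by apply: (nb u) => //; exact: ltW.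
    move=> [v [v0 Xv nv]]; apply: (@le_lt_trans _ _ v%:E); last by rewrite ltry.
    apply: first_time_le (ltW v0) Xv _ => u; rewrite le_eqVlt => /predU1P[<-|u0] uv.
      by rewrite Sw => E; move: xb; rewrite E ltxx.
    by apply: nv => //; exact: ltW.
have sub w : S w -> first_hit X 0 a b w -> first_hit X 0 a' b w.
  move=> Sw [v [v0 Xv nv]]; exists v; split => // u u0 uv Xu.
  have [|q /andP[q0 qu] Xq] := path_IVT (@cX w) (lexx 0%R) (ltW u0) (a := a).
    by rewrite Sw Xu (ltW ax) (ltW a'a) orbT.
  apply: (nv q) => //; last exact: le_trans uv.
  rewrite lt_neqAle q0 andbT; apply/eqP => E.
  by move: ax; rewrite -Sw E Xq ltxx.
have mH (p q : \bar R) : p < q -> measurable (first_hit X 0 p q).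
  by move=> /neq; exact: measurable_first_hit0.
have := strong_markov_first_time hX a b hx (natural_first_hit (neq _ _ a'b)).
rewrite -/S -/D -/U UE setIC (prob_start hX hx); last first.
  by apply: measurableD; exact: mH.
have -> : P x (first_hit X 0 a' b `\` first_hit X 0 a b) =
    P x (first_hit X 0 a' b) - P x (first_hit X 0 a b).
  rewrite measureD; [|exact: mH|exact: mH|]; last first.
    by apply: le_lt_trans (probability_le1 _ _) _; [exact: mH|rewrite ltry].
  congr (_ - _); apply: (eq_prob_start hX hx) => [||w Sw].
  - by apply: measurableI; exact: mH.
  - exact: mH.
  - by split => [[]//|h]; split => //; exact: sub.
rewrite DE (exit_right la' a'x xb br) (exit_right la ax xb br)
  (exit_right la' a'a ab br).
have fF : P x (first_hit X 0 b a) \is a fin_num.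
  by apply: fin_num_measure; apply: measurable_first_hit0 => E; move: ab; rewrite E ltxx.
rewrite -(fineK fF) -EFinB -EFinM => -[E]; congr (_%:E).
have s1 := scale_lt la' a'a (lt_trans ab br).
have s2 := scale_lt la ab br.
have s0 := scale_lt la' a'b br.
set p := fine (P x _) in E *.
have e1 : (sigma b - sigma a' != 0)%R by rewrite gt_eqF// subr_gt0.
have e2 : (sigma b - sigma a != 0)%R by rewrite gt_eqF// subr_gt0.
have e3 : (sigma a - sigma a' != 0)%R by rewrite gt_eqF// subr_gt0.
have : ((sigma a - sigma a') / (sigma b - sigma a') * p =
  (sigma a - sigma a') / (sigma b - sigma a') * ((sigma b - sigma x) / (sigma b - sigma a)))%R.
  by rewrite -E; field; rewrite e1 e2.
by apply: mulfI; rewrite mulf_neq0// invr_eq0.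
Qed.

End exit.

(** The probability of exit at the upper end for the reflected process is that of
    exit at the lower end for the original one, given by exit_left. *)
Lemma reflect_scale (R : realType) (d : measure_display)
  (Omega : measurableType d) (l r : \bar R) (X : R -> Omega -> \bar R)
  (theta : R -> Omega -> Omega) (P : \bar R -> probability Omega R)
  (s : \bar R -> \bar R) :
  regular_diffusion l r X P theta -> scale_function l r X P s ->
  scale_function (- r) (- l) (fun u w => - X u w) (fun x => P (- x))
    (fun x => - s (- x)).
Proof.
move=> hX hs; split.
- move=> x /andP[rx xl]; rewrite fin_numN; apply: (scale_fin_num hs).
  by rewrite lteNr xl lteNl rx.
- move=> x y rx xy yl; rewrite lteN2; apply: (scale_increasing hs).
  + by rewrite lteNr.
  + by rewrite lteN2.
  + by rewrite lteNl.
- apply/subspace_continuousP => x /state_space_reflect hx.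
  apply: cvgeN => V Vx.
  have /subspace_continuousP/(_ _ hx V Vx) := scale_continuous hs.
  rewrite /within /= nbhsNe => -[W xW hW].
  rewrite !nbhs_simpl /=; apply: filterS xW => u Wu /state_space_reflect.
  by have : (-%E @` W) (- u) by [exists u]; rewrite hW; apply.
- move=> a x b ra ax xb bl.
  have lb : l < - b by rewrite lteNr.
  have bx : - b < - x by rewrite lteN2.
  have xa : - x < - a by rewrite lteN2.
  have ar : - a < r by rewrite lteNl.
  transitivity (P (- x) (first_hit X 0 (- a) (- b))).
    have ba := lt_trans bx xa.
    have ha : l < - a < r by rewrite ar (lt_trans lb).
    have hb : l < - b < r by rewrite lb (lt_trans ba).
    have nab : - a <> - b by move=> E; rewrite E ltxx in ba.
    congr (P _ _); apply/seteqP; split => w /=; rewrite !hitting_time_reflect;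
      move=> /(hitting_lt_interior (@diffusion_cont _ _ _ _ _ _ _ _ hX w)
        (@diffusion_absorb _ _ _ _ _ _ _ _ hX w) ha hb nab) //.
  rewrite (exit_left hX hs)// !fineN; congr (_%:E); congr (_ / _)%R.
    by rewrite opprK addrC.
  by rewrite opprK addrC.
Qed.

(** * One-sided hitting probabilities *)

(** The probability that the diffusion started at x in ]y, z[ reaches z without
    visiting y.  If s y = -oo, then y = l, and 1 is the limit of the ratio for a
    in place of y as a decreases to l. *)
Definition hit_prob (R : realType) (s : \bar R -> \bar R) (y x z : \bar R) : R :=
  if s y == -oo then 1%R
  else ((fine (s x) - fine (s y)) / (fine (s z) - fine (s y)))%R.

Section one_sided.
Context (R : realType) (d : measure_display) (Omega : measurableType d).
Context (l r : \bar R) (X : R -> Omega -> \bar R) (theta : R -> Omega -> Omega).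
Context (P : \bar R -> probability Omega R) (s : \bar R -> \bar R).
Implicit Types (u v t : R) (a b x y z : \bar R) (w : Omega).
Hypothesis hlr : l < r.
Hypothesis hX : regular_diffusion l r X P theta.
Hypothesis hs : scale_function l r X P s.

Let sX := diffusion_itv hX.
Let cX := diffusion_cont hX.
Let aX := diffusion_absorb hX.
Local Notation sigma := (fun x => fine (s x)).

Lemma scale_cvg (c : nat -> \bar R) x : state_space l r x ->
  (forall n, state_space l r (c n)) -> c n @[n --> \oo] --> x ->
  s (c n) @[n --> \oo] --> s x.
Proof.
move=> hx hc cx V Vx.
have /subspace_continuousP/(_ _ hx V Vx) := scale_continuous hs.
move=> /cx; rewrite !nbhs_simpl /= => h.
by apply: filterS h => n /=; apply; exact: hc.
Qed.

(** At the boundary, s is the limit of its values along a monotone sequence, one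
    term of which can be inserted strictly between the two points. *)
Lemma scale_mono x y : l <= x -> x < y -> y <= r -> s x < s y.
Proof.
have mono p q : l < p -> p <= q -> q < r -> s p <= s q.
  move=> lp; rewrite le_eqVlt => /predU1P[->//|pq] qr.
  exact/ltW/(scale_increasing hs).
have lower q : l < q -> q < r -> s l < s q.
  move=> lq qr; have [a [ab am _ al]] := approach_inf lq.
  have hn n : l < a n < r.
    by have /andP[-> h] := ab n; rewrite (lt_trans h).
  have /andP[la0 a0q] := ab 0%N.
  apply: (@le_lt_trans _ _ (s (a 0%N))); last exact: (scale_increasing hs).
  have : s (a n) @[n --> \oo] --> s l.
    apply: scale_cvg al; first by rewrite /state_space /= lexx ltW.
    by move=> n; rewrite /state_space /=; have /andP[/ltW -> /ltW ->] := hn n.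
  move=> H; apply: (cvge_le _ H); apply: filterE => n.
  by apply: mono; [have /andP[] := hn n|exact: am|have /andP[] := hn 0%N].
have upper q : l < q -> q < r -> s q < s r.
  move=> lq qr; have [a [ab am ar]] := approach_sup qr.
  have ac := approach_cvg ab am ar.
  have hn n : l < a n < r.
    by have /andP[h ->] := ab n; rewrite (lt_trans lq h).
  have /andP[qa0 a0r] := ab 0%N.
  apply: (@lt_le_trans _ _ (s (a 0%N))); first exact: (scale_increasing hs).
  have : s (a n) @[n --> \oo] --> s r.
    apply: scale_cvg ac; first by rewrite /state_space /= lexx ltW.
    by move=> n; rewrite /state_space /=; have /andP[/ltW -> /ltW ->] := hn n.
  move=> H; apply: (cvge_ge _ H); apply: filterE => n.
  by apply: mono; [have /andP[] := hn 0%N|exact: am|have /andP[] := hn n].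
move=> lx xy yr; move: (lx) (yr); rewrite !le_eqVlt.
move=> /predU1P[E|lx'] /predU1P[E'|yr'].
- subst x y; have [c [cb _ _]] := approach_sup hlr.
  have /andP[lc cr] := cb 0%N.
  exact: lt_trans (lower _ lc cr) (upper _ lc cr).
- by subst x; exact: lower.
- by subst y; apply: upper => //; exact: lt_le_trans xy yr.
- exact: (scale_increasing hs).
Qed.

Lemma first_hit_mono a a' b w : a' <= a -> a < X 0%R w ->
  first_hit X 0 a b w -> first_hit X 0 a' b w.
Proof.
rewrite le_eqVlt => /predU1P[->//|a'a] a0 [v [v0 Xv nv]].
exists v; split => // u u0 uv Xu.
have [|q /andP[q0 qu] Xq] := path_IVT (@cX w) (lexx 0%R) (ltW u0) (a := a).
  by rewrite Xu (ltW a0) (ltW a'a) orbT.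
apply: (nv q) => //; last exact: le_trans uv.
rewrite lt_neqAle q0 andbT; apply/eqP => E.
by move: a0; rewrite -Xq E ltxx.
Qed.

(** For y = l, a path that reaches z at time v stays above some a > l up to v, by
    compactness and absorption; so the event is the increasing union over a of
    the events of reaching z before a. *)
Lemma prob_hit_interior y x z : l <= y -> y < x -> x < z -> z < r ->
  P x (first_hit X 0 y z) = (hit_prob s y x z)%:E.
Proof.
rewrite le_eqVlt => /predU1P[<-{y}|ly] yx xz zr; last first.
  rewrite (exit_right hX hs ly yx xz zr) /hit_prob ifF//.
  by apply/eqP => E; have := scale_fin_num hs (x := y); rewrite E ly
    (lt_trans yx (lt_trans xz zr)) => /(_ isT).
have xr := lt_trans xz zr; have lz := lt_trans yx xz.
have hx : state_space l r x by rewrite /state_space /= !ltW.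
have hl : state_space l r l by rewrite /state_space /= lexx ltW.
have [a [ab am al ac]] := approach_inf yx.
have hit n : P x (first_hit X 0 (a n) z) =
    ((sigma x - sigma (a n)) / (sigma z - sigma (a n)))%:E.
  by have /andP[? ?] := ab n; apply: (exit_right hX hs).
have nlz : l <> z by move=> E; move: lz; rewrite -E ltxx.
have naz n : a n <> z.
  by move=> E; have /andP[_] := ab n; rewrite E ltNge ltW.
pose S := [set w | X 0%R w = x].
have mS : measurable S := measurable_start hX x.
pose F n := first_hit X 0 (a n) z `&` S.
have mF n : measurable (F n).
  by apply: measurableI => //; exact: measurable_first_hit0 hX _ _ (naz n).
have PF n : P x (F n) = ((sigma x - sigma (a n)) / (sigma z - sigma (a n)))%:E.
  by rewrite -hit; apply: (prob_start hX hx); exact: measurable_first_hit0 hX _ _ (naz n).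
have UF : \bigcup_n F n = first_hit X 0 l z `&` S.
  apply/seteqP; split => w.
    move=> [n _ [Fw Sw]]; split => //; have /andP[lan anx] := ab n.
    by apply: first_hit_mono Fw; rewrite ?Sw ?ltW.
  move=> [[v [v0 Xv nv]] Sw].
  have [c /andP[c0 cv] cmin] := path_min (@cX w) (lexx 0%R) (ltW v0).
  have lXc : l < X c w.
    have /andP[+ _] := @sX w c c0; rewrite le_eqVlt => /predU1P[E|//].
    exfalso; apply: nlz; rewrite -Xv E; apply/esym/aX; first by rewrite c0.
    by left.
  have [n hn] := al _ lXc; exists n => //; split => //; exists v; split => //.
  move=> u u0 uv Xu; have := cmin u; rewrite (ltW u0) uv => /(_ isT).
  by rewrite Xu leNgt hn.
have mU : measurable (first_hit X 0 l z).
  exact: measurable_first_hit0 hX _ _ nlz.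
have ndF : {homo F : n m / (n <= m)%N >-> (n <= m)%O}.
  move=> n m nm; apply/subsetPset => w [Fw Sw]; split => //.
  have /andP[_ anx] := ab n.
  by apply: first_hit_mono Fw; rewrite ?Sw//; exact: am.
have cF : P x (F n) @[n --> \oo] --> P x (first_hit X 0 l z).
  rewrite -(prob_start hX hx mU) -/S -UF; apply: nondecreasing_cvg_mu => //.
  exact: bigcup_measurable.
have sa : s (a n) @[n --> \oo] --> s l.
  apply: scale_cvg => // n; have /andP[/ltW lan /ltW anx] := ab n.
  by rewrite /state_space /= lan (le_trans anx)// ltW.
have san n : s (a n) = (sigma (a n))%:E.
  by apply: (scale_fineK hs); have /andP[-> h] := ab n; rewrite (lt_trans h).
have pos n : (0 < sigma z - sigma (a n))%R.
  rewrite subr_gt0; have /andP[h1 h2] := ab n.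
  by apply: (scale_lt hs) => //; exact: lt_trans xz.
rewrite /hit_prob; case: eqP => sl.
  set p := P x _ in cF *.
  have pf : p \is a fin_num by exact: fin_num_measure.
  rewrite -(fineK pf); congr (_%:E); apply/eqP; rewrite eq_le.
  have -> /= : (fine p <= 1)%R by rewrite -lee_fin fineK// probability_le1.
  rewrite leNgt; apply/negP => p1.
  (* if p < 1, then sigma z - sigma a would be at most K for all a > l *)
  pose K := ((sigma z - sigma x) / (1 - fine p))%R.
  have p1' : (0 < 1 - fine p)%R by rewrite subr_gt0.
  have slK : s l < (sigma z - K)%:E by rewrite sl ltNyr.
  have [N _ hN] := sa [set e | e < (sigma z - K)%:E] (open_ereal_lt' slK).
  have := hN N (leqnn N); rewrite /= san lte_fin ltrBrDl -ltrBrDr => KN.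
  have : P x (F N) <= p.
    rewrite /p -(prob_start hX hx mU) -/S -UF; apply: le_measure; rewrite ?inE//.
      exact: bigcup_measurable.
    exact: bigcup_sup.
  rewrite PF -(fineK pf) lee_fin ler_pdivrMr// => Hp.
  move: KN; rewrite /K ltr_pdivrMr// => KN.
  set A := (sigma z - sigma (a N))%R in Hp KN.
  have e : (sigma z - sigma x = A - (sigma x - sigma (a N)))%R by rewrite /A; ring.
  rewrite e in KN; move: Hp KN; rewrite (mulrBr A 1%R) mulr1 (mulrC (fine p)); lra.
have slf : s l \is a fin_num.
  rewrite fin_numE; apply/andP; split; first exact/eqP.
  by rewrite lt_eqF// (lt_le_trans (scale_mono (lexx l) yx (ltW xr)))// leey.
apply: (cvg_unique (@ereal_hausdorff R) cF).
rewrite (_ : (fun n => P x (F n)) =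
    (fun n => ((sigma x - sigma (a n)) / (sigma z - sigma (a n)))%:E)); last first.
  by apply/funext => n; exact: PF.
apply: cvg_EFin; first exact: filterE.
have fa : sigma (a n) @[n --> \oo] --> sigma l.
  by apply: fine_cvg; rewrite fineK.
apply: cvgM; first by apply: cvgB fa; exact: cvg_cst.
apply: cvgV; last by apply: cvgB fa; exact: cvg_cst.
rewrite gt_eqF// subr_gt0 -lte_fin fineK// -(scale_fineK hs) ?lz//.
by apply: scale_mono => //; exact: ltW.
Qed.

End one_sided.

(** * Convergence to an end of finite scale *)

Lemma first_hit_reflect (R : realType) d (Omega : measurableType d)
    (X : R -> Omega -> \bar R) t a b :
  first_hit (fun u w => - X u w) t (- a) (- b) = first_hit X t a b.
Proof.
apply/seteqP; split => w [v [tv Xv nv]]; exists v; split => //.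
- exact: oppe_inj.
- by move=> u tu uv Xu; apply: (nv u tu uv); rewrite Xu.
- by rewrite Xv.
- by move=> u tu uv /oppe_inj Xu; apply: (nv u tu uv).
Qed.

(** By the intermediate value property, a path that is above c at time n and does
    not visit c afterwards stays above c. *)
Lemma measurable_tends_up d (Omega : measurableType d) (R : realType)
    (X : R -> Omega -> \bar R) (l r : \bar R) : l < r ->
  (forall w, {within [set u : R | (0 <= u)%R], continuous (X ^~ w)}) ->
  (forall u, (0 <= u)%R -> measurable_fun setT (X u)) ->
  measurable [set w | tends_up r (X ^~ w)].
Proof.
move=> lr cX mX; have [c [cb cm cr]] := approach_sup lr.
rewrite [X in measurable X](_ : _ = \bigcap_m \bigcup_(n : nat)
    ([set w | c m < X n%:R w] `\` visit_after X n%:R (c m))).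
  apply: bigcapT_measurable => m; apply: bigcupT_measurable => n.
  apply: measurableD.
    by rewrite -[X in measurable X]setTI; apply: emeasurable_fun_o_infty => //; exact: mX.
  by apply: measurable_visit_after => // u nu; apply: mX; exact: le_trans nu.
apply/seteqP; split => w.
  move=> H m _; have /andP[_ mr] := cb m; have [n hn] := H _ mr.
  exists n => //; split; first exact: hn.
  by move=> [u nu Xu]; have := hn u (ltW nu); rewrite Xu ltxx.
move=> H b /cr[m bm]; have [n _ [cn nv]] := H m I.
exists n => u nu; apply: (lt_trans bm); rewrite ltNge; apply/negP => Xu.
have [|q /andP[nq qu] Xq] := path_IVT (@cX w) (ler0n R n) nu (a := c m).
  by rewrite Xu (ltW cn) orbT.
apply: nv; exists q => //; rewrite lt_neqAle nq andbT; apply/eqP => E.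
by move: cn; rewrite /= E Xq ltxx.
Qed.

Section top.
Context (R : realType) (d : measure_display) (Omega : measurableType d).
Context (l r : \bar R) (X : R -> Omega -> \bar R) (theta : R -> Omega -> Omega).
Context (P : \bar R -> probability Omega R) (s : \bar R -> \bar R).
Implicit Types (u v t : R) (a b c x y z : \bar R) (w : Omega).
Hypothesis hlr : l < r.
Hypothesis hX : regular_diffusion l r X P theta.
Hypothesis hs : scale_function l r X P s.

Let sX := diffusion_itv hX.
Let cX := diffusion_cont hX.
Let aX := diffusion_absorb hX.
Local Notation sigma := (fun x => fine (s x)).

Lemma scale_top_fin : s r < +oo -> s r = (sigma r)%:E.
Proof.
move=> sr; rewrite fineK// fin_numE (lt_eqF sr) andbT gt_eqF//.
by rewrite (le_lt_trans (leNye (s l)))// (scale_mono hlr hs).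
Qed.

Lemma scale_lt_top c : l < c -> c < r -> s r < +oo -> (sigma c < sigma r)%R.
Proof.
move=> lc cr sr; rewrite -lte_fin -scale_top_fin// -(scale_fineK hs) ?lc//.
exact: (scale_mono hlr hs (ltW lc)).
Qed.

Lemma prob_hit_below_top b c : l < c -> c < b -> b < r -> s r < +oo ->
  P b (first_hit X 0 r c) = ((sigma r - sigma b) / (sigma r - sigma c))%:E.
Proof.
move=> lc cb br sr; rewrite -first_hit_reflect.
have rl : - r < - l by rewrite lteN2.
have := prob_hit_interior rl (reflect_diffusion hX) (reflect_scale hX hs)
  (y := - r) (x := - b) (z := - c).
rewrite !lteN2 lexx => /(_ isT br cb lc); rewrite oppeK => ->.
rewrite /hit_prob !oppeK ifF; last first.
  by apply/eqP => E; move: sr; rewrite -(oppeK (s r)) E.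
by congr (_%:E); congr (_ / _)%R; rewrite !fineN opprK addrC.
Qed.

Lemma top_ratio_cvg (c : \bar R) (b : nat -> \bar R) : l < c -> c < r ->
  s r < +oo -> (forall n, l < b n < r) -> b n @[n --> \oo] --> r ->
  (sigma (b n)) @[n --> \oo] --> sigma r.
Proof.
move=> lc cr sr hb br; apply: fine_cvg; rewrite -scale_top_fin//.
apply: (scale_cvg hs) => //; first by rewrite /state_space /= lexx ltW.
by move=> n; have /andP[/ltW h1 /ltW h2] := hb n; rewrite /state_space /= h1.
Qed.

(** After hitting b, the diffusion goes down to c with a probability that
    vanishes as b tends to r. *)
Lemma ae_no_return x c : l < x -> x < r -> l < c -> c < r -> s r < +oo ->
  \forall w \ae P x, (forall b, x < b -> b < r -> exists2 u, (0 <= u)%R & X u w = b) ->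
    exists n : nat, forall u, (n%:R <= u)%R -> c < X u w.
Proof.
move=> lx xr lc cr sr.
have hx : state_space l r x by rewrite /state_space /= !ltW.
have mr : maxe x c < r by rewrite gt_max xr.
have [b [bb bm br]] := approach_sup mr.
have hb n : [/\ x < b n, c < b n & b n < r].
  by have /andP[+ ->] := bb n; rewrite gt_max => /andP[].
pose S := [set w | X 0%R w = x].
(* after a visit to b n, c is visited; a rational time separates the visits *)
pose M n := \bigcup_(k in [set k : rat | (0 <= ratr k :> R)%R])
  ([set w | exists2 u, (0 <= u <= ratr k)%R & X u w = b n] `&`
   visit_after X (ratr k) c).
have mM n : measurable (M n).
  rewrite /M bigcup_mkcond; apply: bigcupT_measurable_rat => k; case: ifPn => //.
  rewrite inE /= => k0; apply: measurableI.
    by apply: measurable_visit_cc => // u /andP[u0 _]; exact: (measurableX hX).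
  by apply: measurable_visit_after => // u ku; apply: (measurableX hX); exact: le_trans ku.
have nrc : r <> c by move=> E; move: cr; rewrite E ltxx.
pose D n := first_time X (b n) (b n).
have SM n : S `&` [set w | D n w < +oo /\
    first_hit X 0 r c (theta (fine (D n w)) w)] = S `&` M n.
  have [xb cb rb] := hb n.
  apply/seteqP; split => w [Sw].
    move=> [/(first_timeP hX)[t [t0 Et Xt _ _]]]; rewrite /D Et /=.
    move=> [v [v0 Xv _]]; rewrite (diffusion_shift hX) ?(ltW v0)// in Xv.
    split => //; have : (t < v + t)%R by rewrite ltrDr.
    move=> /rat_in_itvoo[k]; rewrite in_itv /= => /andP[tk kv].
    exists k; first by rewrite /= (le_trans t0)// ltW.
    split; first by exists t => //; rewrite t0 ltW.
    by exists (v + t)%R.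
  move=> [k /= k0 [[u /andP[u0 uk] Xu] [q kq Xq]]]; split => //.
  have [t' [/andP[t'0 t'u] Xt' nt']] := first_visit (@cX w) (lexx 0%R) u0 Xu.
  have Dle := first_time_le t'0 Xt' nt'.
  have Dfin : D n w < +oo by apply: le_lt_trans Dle _; rewrite ltry.
  split => //; have [t [t0 Et Xt _ _]] := first_timeP hX Dfin.
  rewrite /D Et /=; have tu : (t <= u)%R by rewrite (le_trans _ t'u)// -lee_fin -Et.
  have tq : (t < q)%R := le_lt_trans tu (le_lt_trans uk kq).
  exists (q - t)%R; split; rewrite ?subr_gt0//.
    by rewrite (diffusion_shift hX) ?subrK// subr_ge0 ltW.
  move=> p p0 pq; rewrite (diffusion_shift hX) ?(ltW p0)// => Xp.
  apply: nrc; rewrite -Xq -Xp; apply/esym/aX; last by right.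
  by rewrite addr_ge0 ?(ltW p0)//= -lerBrDr.
have mS : measurable S := measurable_start hX x.
have PM n : P x (S `&` M n) <= ((sigma r - sigma (b n)) / (sigma r - sigma c))%:E.
  have [xb cb rb] := hb n.
  rewrite -SM (strong_markov_first_time hX _ _ hx (natural_first_hit hX nrc)).
  rewrite prob_hit_below_top// -[leRHS]mule1; apply: lee_wpmul2l.
    by rewrite lee_fin divr_ge0// subr_ge0 ltW// scale_lt_top// (lt_trans lx).
  by apply: probability_le1; exact: measurable_first_time_fin hX _ _.
pose N := \bigcap_n (S `&` M n).
have mN : measurable N by apply: bigcapT_measurable => n; exact: measurableI.
have N0 : P x N = 0.
  have bc : b n @[n --> \oo] --> r by apply: approach_cvg bb bm br.
  have hbn n : l < b n < r by have [h _ ->] := hb n; rewrite (lt_trans lx h).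
  have sb := top_ratio_cvg lc cr sr hbn bc.
  have lim0 : ((sigma r - sigma (b n)) / (sigma r - sigma c))%:E @[n --> \oo] --> 0.
    apply: cvg_EFin; first exact: filterE.
    rewrite -[X in _ --> X](mul0r ((sigma r - sigma c)^-1)%R).
    apply: cvgM; last exact: cvg_cst.
    have e0 : (sigma r - sigma r = 0)%R by rewrite subrr.
    rewrite -e0.
    by apply: cvgB sb; exact: cvg_cst.
  apply/eqP; rewrite eq_le measure_ge0 andbT.
  apply: (cvge_ge _ lim0); apply: filterE => n; apply: le_trans (PM n).
  by apply: le_measure; rewrite ?inE//; [exact: measurableI|exact: bigcap_inf].
have aeN : \forall w \ae P x, ~ N w by exists N; split => // w /contrapT.
apply: filterS2 (ae_start hX hx) aeN => w Sw nNw H.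
apply: contrapT => /forallNP nex; apply: nNw => n _; split => //.
have [xb cb rb] := hb n.
have [u u0 Xu] := H _ xb rb.
have /existsNP[q /not_implyP[qb Xq]] := nex (Num.bound u).
have uq : (u < q)%R by apply: lt_le_trans qb; exact: archi_boundP.
have {}Xq : X q w <= c by rewrite leNgt; apply/negP.
have [|p /andP[up pq] Xp] := path_IVT (@cX w) u0 (ltW uq) (a := c).
  by rewrite Xu Xq (ltW cb) orbT.
have {}up : (u < p)%R.
  by rewrite lt_neqAle up andbT; apply/eqP => E; move: cb; rewrite -Xu E Xp ltxx.
have [k] := rat_in_itvoo up; rewrite in_itv /= => /andP[uk kp].
exists k; first by rewrite /= (le_trans u0)// ltW.
by split; [exists u => //; rewrite u0 ltW|exists p].
Qed.

(** A path that visits every b < r returns below c after each of these visits if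
    it does not stay above c eventually. *)
Lemma ae_tends_up x : l < x -> x < r -> s r < +oo ->
  \forall w \ae P x,
    (forall b, x < b -> b < r -> exists2 u, (0 <= u)%R & X u w = b) ->
    tends_up r (X ^~ w).
Proof.
move=> lx xr sr; have [c [cb _ cr]] := approach_sup hlr.
have := ae_foralln (fun n => ae_no_return lx xr (proj1 (andP (cb n)))
  (proj2 (andP (cb n))) sr).
apply: filterS => w H hits b /cr[n bn].
have [m hm] := H n hits; exists m => u mu.
exact: lt_trans bn (hm u mu).
Qed.

Lemma natural_clean_hit y z : y <> z -> l <= z <= r ->
  natural_sigma X setT [set w | clean_hit r y z 0 (X ^~ w)].
Proof.
move=> yz hz; rewrite /clean_hit.
have mX u : (0 <= u)%R ->
    measurable_fun [set: g_sigma_algebraType (natural_gen X setT)]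
      (X u : g_sigma_algebraType (natural_gen X setT) -> _).
  by move=> u0; apply: natural_measurableX.
have [zr|zr] := eqVneq z r; last exact: (natural_first_hit hX yz).
rewrite [X in natural_sigma _ _ X](_ : _ =
    [set w | tends_up r (X ^~ w)] `&` ~` visit_after X 0 y).
  apply: (@measurableI _ (g_sigma_algebraType (natural_gen X setT))).
    exact: (@measurable_tends_up _ (g_sigma_algebraType (natural_gen X setT)) _ X l r).
  apply: (@measurableC _ (g_sigma_algebraType (natural_gen X setT))).
  exact: (natural_visit_after hX y (lexx 0%R)).
apply/seteqP; split => w [H1 H2]; split => //.
  by move=> [u u0 Xu]; apply: (H2 u).
by move=> u u0 Xu; apply: H2; exists u.
Qed.

(** The event of reaching r without visiting y is, up to a null set, the
    intersection of the events of reaching b without visiting y, for b < r. *)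
Lemma prob_hit_top y x : l <= y -> y < x -> x < r -> s r < +oo ->
  P x [set w | clean_hit r y r 0 (X ^~ w)] = (hit_prob s y x r)%:E.
Proof.
move=> ly yx xr sr; have lx := le_lt_trans ly yx.
have hx : state_space l r x by rewrite /state_space /= !ltW.
have yr := lt_trans yx xr.
have nyr : y <> r by move=> E; move: yr; rewrite E ltxx.
set E := [set w | _].
have mE : measurable E.
  by apply: (natural_measurable hX (natural_clean_hit nyr _)); rewrite lexx ltW.
have [b [bb bm br]] := approach_sup xr.
pose S := [set w | X 0%R w = x].
have mS : measurable S := measurable_start hX x.
pose F n := first_hit X 0 y (b n) `&` S.
have nyb n : y <> b n.
  by move=> E'; have /andP[+ _] := bb n; rewrite -E' ltNge ltW.
have mF n : measurable (F n).
  by apply: measurableI => //; exact: measurable_first_hit0 hX _ _ (nyb n).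
have PF n : P x (F n) = (hit_prob s y x (b n))%:E.
  have /andP[xb b_r] := bb n.
  rewrite -(prob_hit_interior hlr hX hs ly yx xb b_r).
  by apply: (prob_start hX hx); exact: measurable_first_hit0 hX _ _ (nyb n).
have hit_ivt w v a : S w -> x < a -> (0 < v)%R -> a < X v w ->
    exists2 u, (0 < u <= v)%R & X u w = a.
  move=> Sw xa v0 aXv.
  have [|u /andP[u0 uv] Xu] := path_IVT (@cX w) (lexx 0%R) (ltW v0) (a := a).
    by rewrite Sw (ltW xa) (ltW aXv).
  exists u => //; rewrite uv andbT lt_neqAle u0 andbT; apply/eqP => E'.
  by move: xa; rewrite -Sw E' Xu ltxx.
have niF : {homo F : n m / (n <= m)%N >-> (m <= n)%O}.
  move=> n m nm; apply/subsetPset => w [[v [v0 Xv nv]] Sw]; split => //.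
  have [->|bnm] := eqVneq (b n) (b m); first by exists v.
  have {}bnm : b n < b m by rewrite lt_neqAle bnm bm.
  have /andP[xb _] := bb n.
  have [|u /andP[u0 uv] Xu] := hit_ivt w v _ Sw xb v0; first by rewrite Xv.
  by exists u; split => // p p0 pu; apply: nv => //; exact: le_trans uv.
have mI : measurable (\bigcap_n F n) by exact: bigcapT_measurable.
(* the difference is null: visiting every b < r entails convergence to r *)
have PI : P x (\bigcap_n F n) = P x E.
  have aeE := ae_tends_up lx xr sr.
  rewrite -(prob_start hX hx mE) -/S; apply/eqP; rewrite eq_le; apply/andP; split.
    have : \forall w \ae P x, (\bigcap_n F n) w -> (E `&` S) w.
      apply: filterS aeE => w H hF; have Sw : S w by have [] := hF 0%N I.
      split => //; rewrite /E /= /clean_hit eqxx; split.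
        apply: H => a xa ar; have [n an] := br _ ar.
        have [[v [v0 Xv _]] _] := hF n I.
        have [|u /andP[u0 _] Xu] := hit_ivt w v _ Sw xa v0; first by rewrite Xv.
        by exists u => //; exact: ltW.
      move=> u u0 Xu.
      have [c /andP[c0 cu] cmax] := path_max (@cX w) (lexx 0%R) (ltW u0).
      have Xcr : X c w < r.
        have /andP[_] := @sX w c c0; rewrite le_eqVlt => /predU1P[E'|//].
        by exfalso; apply: nyr; rewrite -Xu -E'; apply: aX; [rewrite c0|right].
      have [n hn] := br _ Xcr; have [[v [v0 Xv nv]] _] := hF n I.
      have [uv|vu] := leP u v; first by apply: (nv u).
      have := cmax v; rewrite (ltW v0) (ltW vu) => /(_ isT).
      by rewrite Xv leNgt hn.
    move=> [N [mN N0 HN]].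
    have sub : \bigcap_n F n `<=` (E `&` S) `|` N.
      move=> w Fw; have [ES|nES] := pselect ((E `&` S) w); first by left.
      by right; apply: HN => /(_ Fw).
    apply: (@le_trans _ _ (P x ((E `&` S) `|` N))).
      by apply: le_measure; rewrite ?inE//; apply: measurableU => //; exact: measurableI.
    by rewrite measureU0//; exact: measurableI.
  apply: le_measure; rewrite ?inE//; first exact: measurableI.
  move=> w [Ew Sw] n _; split => //; move: Ew; rewrite /E /= /clean_hit eqxx.
  move=> [tu ny]; have /andP[xb b_r] := bb n; have [m hm] := tu _ b_r.
  have m1 : (0 < m%:R + 1 :> R)%R by rewrite ltr_wpDl.
  have [|v /andP[v0 _] Xv] := hit_ivt w _ _ Sw xb m1.
    by apply: hm; rewrite lerDl.
  by exists v; split => // u u0 _; exact: ny.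
have cF : P x (F n) @[n --> \oo] --> P x E.
  rewrite -PI; apply: nonincreasing_cvg_mu => //.
  by apply: le_lt_trans (probability_le1 _ _) _; [exact: mF|rewrite ltry].
apply: (cvg_unique (@ereal_hausdorff R) cF).
rewrite (_ : (fun n => P x (F n)) = (fun n => (hit_prob s y x (b n))%:E)); last first.
  by apply/funext => n; exact: PF.
apply: cvg_EFin; first exact: filterE.
have sb : sigma (b n) @[n --> \oo] --> sigma r.
  apply: (top_ratio_cvg lx xr sr); last by apply: approach_cvg bb bm br.
  by move=> n; have /andP[h ->] := bb n; rewrite (lt_trans lx h).
rewrite /hit_prob; have [ly'|ly'] := eqVneq (s y) -oo; first exact: cvg_cst.
have syf : s y \is a fin_num.
  rewrite fin_numE ly' lt_eqF// (lt_le_trans (scale_mono hlr hs ly yr (lexx r)))//.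
  exact: leey.
apply: cvgM; first exact: cvg_cst.
apply: cvgV; last by apply: cvgB sb _; exact: cvg_cst.
rewrite gt_eqF// subr_gt0 -lte_fin fineK// -scale_top_fin//.
exact: (scale_mono hlr hs).
Qed.

End top.

(** * The probability of reaching z without returning to y *)

Section formula.
Context (R : realType) (d : measure_display) (Omega : measurableType d).
Context (l r : \bar R) (X : R -> Omega -> \bar R) (theta : R -> Omega -> Omega).
Context (P : \bar R -> probability Omega R) (s : \bar R -> \bar R).
Implicit Types (u v t : R) (a b c x y z : \bar R) (w : Omega).
Hypothesis hlr : l < r.
Hypothesis hX : regular_diffusion l r X P theta.
Hypothesis hs : scale_function l r X P s.

Let sX := diffusion_itv hX.
Let cX := diffusion_cont hX.
Let aX := diffusion_absorb hX.
Local Notation sigma := (fun x => fine (s x)).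

Lemma prob_clean_hit y x z : l <= y -> y < x -> x < z -> z <= r -> s z < +oo ->
  P x [set w | clean_hit r y z 0 (X ^~ w)] = (hit_prob s y x z)%:E.
Proof.
move=> ly yx xz zr sz; have [zr'|zr'] := eqVneq z r.
  by subst z; exact: (prob_hit_top hlr hX hs).
have {}zr : z < r by rewrite lt_neqAle zr'.
rewrite -(prob_hit_interior hlr hX hs ly yx xz zr); congr (P x _).
by rewrite /clean_hit (negbTE zr').
Qed.

(** Started at or below y, the diffusion does not reach z without visiting y at
    a positive time: from y itself it would have to reach z before every a < y,
    which has probability zero by continuity of the scale function. *)
Lemma prob_clean_hit_below y x z : l <= x -> x <= y -> y < z -> z <= r ->
  P x [set w | clean_hit r y z 0 (X ^~ w)] = 0.
Proof.
move=> lx xy yz zr; have yr := lt_le_trans yz zr.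
have ly := le_trans lx xy; have lz := le_lt_trans ly yz.
have hx : state_space l r x by rewrite /state_space /= lx ltW// (le_lt_trans xy).
have nyz : y <> z by move=> E; move: yz; rewrite E ltxx.
have mE : measurable [set w | clean_hit r y z 0 (X ^~ w)].
  by apply: (natural_measurable hX (natural_clean_hit hlr hX nyz _)); rewrite zr ltW.
have reach w : clean_hit r y z 0 (X ^~ w) -> exists v, [/\ (0 < v)%R,
    y < X v w & forall u, (0 < u)%R -> (u <= v)%R -> X u w <> y].
  rewrite /clean_hit; case: eqP => [_ [tu ny]|_ [v [v0 Xv nv]]].
    have [n hn] := tu _ yr; exists (n%:R + 1)%R; split.
    - by rewrite ltr_wpDl.
    - by apply: hn; rewrite lerDl.
    - by move=> u u0 _; exact: ny.
  by exists v; rewrite Xv.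
have [ylt|] := ltP x y.
  apply/eqP; rewrite eq_le measure_ge0 andbT -(measure0 (P x)).
  apply: (le_prob_start hX hx) => // w Xw /reach[v [v0 Xv nv]].
  have [|u /andP[u0 uv] Xu] := path_IVT (@cX w) (lexx 0%R) (ltW v0) (a := y).
    by rewrite Xw (ltW ylt) (ltW Xv).
  apply: (nv u) => //; rewrite lt_neqAle u0 andbT; apply/eqP => E.
  by move: ylt; rewrite -Xw -Xu -E ltxx.
move=> yx; have {xy yx}E : x = y by apply/eqP; rewrite eq_le xy.
subst x; move: ly; rewrite le_eqVlt => /predU1P[E|ly].
  apply/eqP; rewrite eq_le measure_ge0 andbT -(measure0 (P y)).
  apply: (le_prob_start hX hx) => // w Xw /reach[v [v0 Xv nv]].
  apply: (nv v) => //; rewrite -[RHS]Xw; apply: aX; first by rewrite lexx ltW.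
  by left; rewrite Xw.
have [a [ab am aly]] := approach_sup ly.
have ac := approach_cvg ab am aly.
have [c [cb _ _]] := approach_sup yz; have {cb} /andP[yc cz] := cb 0%N.
move: (c 0%N) yc cz => {}c yc cz.
have cr := lt_le_trans cz zr.
have le n : P y [set w | clean_hit r y z 0 (X ^~ w)] <=
    ((sigma y - sigma (a n)) / (sigma c - sigma (a n)))%:E.
  have /andP[lan anY] := ab n.
  rewrite -(exit_right hX hs lan anY yc cr).
  apply: (le_prob_start hX hx) => //.
    apply: (measurable_first_hit0 hX) => E.
    by move: (lt_trans anY yc); rewrite E ltxx.
  move=> w Xw; rewrite /clean_hit => H.
  have [v [v0 Xv nv]] : exists v, [/\ (0 < v)%R, c < X v w &
      forall u, (0 < u)%R -> (u <= v)%R -> X u w <> y].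
    move: H; case: eqP => [zr' [tu ny]|_ [v [v0 Xv nv]]].
      have [n' hn] := tu _ cr; exists (n'%:R + 1)%R; split.
      - by rewrite ltr_wpDl.
      - by apply: hn; rewrite lerDl.
      - by move=> u u0 _; exact: ny.
    by exists v; rewrite Xv.
  have [|q /andP[q0 qv] Xq] := path_IVT (@cX w) (lexx 0%R) (ltW v0) (a := c).
    by rewrite Xw (ltW yc) (ltW Xv).
  exists q; split => //.
    rewrite lt_neqAle q0 andbT; apply/eqP => E.
    by move: yc; rewrite -Xw E Xq ltxx.
  move=> u u0 uq Xu; have uv := le_trans uq qv.
  have [|p /andP[up pv] Xp] := path_IVT (@cX w) (ltW u0) uv (a := y).
    by rewrite Xu (ltW anY) (ltW (lt_trans yc Xv)).
  by apply: (nv p) => //; exact: lt_le_trans up.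
have lim0 : ((sigma y - sigma (a n)) / (sigma c - sigma (a n)))%:E @[n --> \oo] --> 0.
  have sa : sigma (a n) @[n --> \oo] --> sigma y.
    apply: fine_cvg; rewrite -(scale_fineK hs) ?ly//; apply: (scale_cvg hs) => //.
    move=> n; have /andP[/ltW h1 /ltW h2] := ab n.
    by rewrite /state_space /= h1 (le_trans h2)// ltW.
  have syc : (sigma c - sigma y != 0)%R.
    by rewrite gt_eqF// subr_gt0 (scale_lt hs).
  apply: cvg_EFin; first exact: filterE.
  have e0 : ((sigma y - sigma y) / (sigma c - sigma y) = 0)%R by rewrite subrr mul0r.
  rewrite -e0; apply: cvgM; first by apply: cvgB sa; exact: cvg_cst.
  by apply: cvgV => //; apply: cvgB sa; exact: cvg_cst.
apply/eqP; rewrite eq_le measure_ge0 andbT.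
by apply: (cvge_ge _ lim0); apply: filterE.
Qed.

Lemma scale_fin_num_gt y z : l <= y -> y < z -> z <= r -> s z < +oo ->
  s z \is a fin_num.
Proof.
move=> ly yz zr sz; rewrite fin_numE (lt_eqF sz) andbT gt_eqF//.
by rewrite (le_lt_trans (leNye (s y)))// (scale_mono hlr hs).
Qed.

(** The identity on which everything rests.  It holds from every starting point
    below z, including l, so that it can be applied to the position X_t of a path
    that has not visited z. *)
Lemma scale_formula y x z : l <= x -> x < z -> l <= y -> y < z -> z <= r ->
  s z < +oo ->
  maxe (s x - s y) 0 =
  (s z - s y) * P x [set w | clean_hit r y z 0 (X ^~ w)].
Proof.
move=> lx xz ly yz zr sz; have [xy|yx] := leP x y.
  rewrite (prob_clean_hit_below lx xy yz zr) mule0.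
  have : s x <= s y.
    move: xy; rewrite le_eqVlt => /predU1P[->//|xy].
    by rewrite ltW// (scale_mono hlr hs)// ltW// (lt_le_trans yz).
  move=> sxy; apply/max_idPr; rewrite /maxe.
  case: (s x) (s y) sxy => [p| |] [q| |] //=; rewrite ?lee_fin ?leNye// => pq.
  by rewrite subr_le0.
rewrite (prob_clean_hit ly yx xz zr sz).
have szf := scale_fin_num_gt ly yz zr sz.
have xr := lt_le_trans xz zr.
have sxf : s x \is a fin_num.
  by apply: (scale_fin_num hs); rewrite xr (le_lt_trans ly yx).
have syx : s y < s x by apply: (scale_mono hlr hs) => //; exact: ltW.
have sxz : s x < s z by apply: (scale_mono hlr hs).
rewrite /hit_prob; have [sy|sy] := eqVneq (s y) -oo.
  by rewrite sy /= -(fineK szf) -(fineK sxf) /= mule1.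
have syf : s y \is a fin_num by rewrite fin_numE sy lt_eqF// (lt_le_trans syx)// leey.
move: syx sxz; rewrite -(fineK szf) -(fineK sxf) -(fineK syf) !lte_fin /= => syx sxz.
rewrite -!EFinB -EFinM -EFin_max; congr (_%:E).
rewrite mulrC divfK; last by rewrite gt_eqF// subr_gt0 (lt_trans syx).
by apply/max_idPl; rewrite subr_ge0 ltW.
Qed.

(** If s l = -oo, then z is reached with probability 1.  Otherwise the
    probability of reaching z, and that of tending to l without visiting z, which
    is given by the same formula for the reflected diffusion, add up to 1. *)
Lemma ae_hit_or_bottom x z : l < x -> x < z -> z <= r -> s z < +oo ->
  \forall w \ae P x, hits_before l r X z l w \/
    (left_limit_is l r X l w /\ hitting_time l r X z w = lifetime l r X w).
Proof.
move=> lx xz zr sz; have lz := lt_trans lx xz; have xr := lt_le_trans xz zr.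
have hx : state_space l r x by rewrite /state_space /= !ltW.
have hz : l <= z <= r by rewrite zr ltW.
have nlz : l <> z by move=> E; move: lz; rewrite E ltxx.
pose E := [set w | clean_hit r l z 0 (X ^~ w)].
have mE : measurable E by exact: (natural_measurable hX (natural_clean_hit hlr hX nlz hz)).
have alive w : X 0%R w = x -> l < X 0%R w < r by move=> ->; rewrite lx.
have EH w : X 0%R w = x -> E w -> hits_before l r X z l w.
  move=> Xw Ew.
  have nz u : (0 <= u)%R -> (u <= 0)%R -> X u w <> z.
    move=> u0 u0'; have -> : u = 0%R by apply/eqP; rewrite eq_le u0 u0'.
    by rewrite Xw => E'; move: xz; rewrite E' ltxx.
  have [||H _] := (hits_before_last_passageP hlr (@sX w) (@cX w) (@aX w) (alive w Xw)
    (lexx 0%R) _ _ nz).2 Ew => //.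
    by rewrite lz.
  by rewrite lexx.
have [sl|sl] := eqVneq (s l) -oo.
  have PE : P x E = 1.
    by rewrite (prob_clean_hit (lexx l) lx xz zr sz) /hit_prob sl eqxx.
  have aeE : \forall w \ae P x, E w.
    exists (~` E); split => //; first exact: measurableC.
    by rewrite probability_setC// PE subee.
  by apply: filterS2 (ae_start hX hx) aeE => w Xw Ew; left; exact: EH.
have hX' := reflect_diffusion hX; have hs' := reflect_scale hX hs.
have rl : - r < - l by rewrite lteN2.
pose E' := [set w | clean_hit (- l) (- z) (- l) 0 (fun u => - X u w)].
have mE' : measurable E'.
  apply: (natural_measurable hX' (natural_clean_hit rl hX' _ _)).
    by move=> /oppe_inj /esym.
  by rewrite lexx ltW.
have PE' : P x E' = (hit_prob (fun x => (- s (- x))%E) (- z) (- x) (- l))%:E.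
  have := prob_hit_top rl hX' hs' (y := - z) (x := - x).
  rewrite leeN2 !lteN2 !oppeK => /(_ zr xz lx); apply.
  by rewrite lteNl ltNye.
have slf : s l \is a fin_num.
  rewrite fin_numE sl lt_eqF// (lt_le_trans (scale_mono hlr hs (lexx l) lx (ltW xr)))//.
  exact: leey.
have szf := scale_fin_num_gt (lexx l) lz zr sz.
have tendsE w : X 0%R w = x -> E' w -> left_limit_is l r X l w /\
    forall u, (0 < u)%R -> X u w <> z.
  move=> Xw; rewrite /E' /= /clean_hit eqxx => -[tu nz]; split.
    rewrite -[X in left_limit_is _ _ _ X](oppeK l) -left_limit_is_reflect.
    have alive' : - r < - X 0%R w < - l.
      by rewrite !lteN2 andbC alive.
    rewrite /left_limit_is /=; apply/(left_limit_cvg (@diffusion_itv _ _ _ _ _ _ _ _ hX' w)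
      (@diffusion_cont _ _ _ _ _ _ _ _ hX' w) (@diffusion_absorb _ _ _ _ _ _ _ _ hX' w)).
      exact: (lifetime_alive0 (@diffusion_cont _ _ _ _ _ _ _ _ hX' w)
        (@diffusion_absorb _ _ _ _ _ _ _ _ hX' w)).
    exact/(tends_upP rl (@diffusion_itv _ _ _ _ _ _ _ _ hX' w)).
  by move=> u u0 Xu; apply: (nz u u0); rewrite Xu.
have missE w : X 0%R w = x -> E' w -> left_limit_is l r X l w /\
    hitting_time l r X z w = lifetime l r X w.
  move=> Xw /(tendsE w Xw)[H nz]; split => //.
  by rewrite /hitting_time; case: pselect => // -[u [u0 Xu]]; case: (nz u u0).
have disj w : X 0%R w = x -> E w -> E' w -> False.
  move=> Xw; rewrite /E /= /clean_hit; case: eqP => [zr' [tu _]|_ [v [v0 Xv _]]].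
    have [c [cb _ _]] := approach_sup hlr; have /andP[lc cr] := cb 0%N.
    rewrite /E' /= /clean_hit eqxx => -[tu' _].
    have [n hn] := tu _ cr.
    have [m hm] : exists m : nat, forall u, (m%:R <= u)%R -> - c 0%N < - X u w.
      by apply: tu'; rewrite lteN2.
    have h1 : (n%:R <= Num.max n%:R m%:R :> R)%R by rewrite le_max lexx.
    have h2 : (m%:R <= Num.max n%:R m%:R :> R)%R by rewrite le_max lexx orbT.
    have := hm _ h2; rewrite lteN2 => /lt_trans/(_ (hn _ h1)).
    by rewrite ltxx.
  by move=> /(tendsE w Xw)[_ nz]; apply: (nz v v0).
pose S := [set w | X 0%R w = x].
have mS : measurable S := measurable_start hX x.
have P1 : P x ((E `&` S) `|` (E' `&` S)) = 1.
  have -> : P x ((E `&` S) `|` (E' `&` S)) = P x (E `&` S) + P x (E' `&` S).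
    rewrite measureU//; [exact: measurableI|exact: measurableI|].
    by apply/seteqP; split => // w [[Ew Sw] [E'w _]]; exact: (disj w Sw).
  rewrite !(prob_start hX hx)//.
  rewrite (prob_clean_hit (lexx l) lx xz zr sz) PE' /hit_prob (negbTE sl) eqe_oppLR /= !oppeK.
  rewrite (lt_eqF sz) -EFinD; congr (_%:E).
  have szl : (sigma l < sigma z)%R.
    by rewrite -lte_fin !fineK//; apply: (scale_mono hlr hs).
  rewrite !fineN; field.
  by rewrite opprK addrC gt_eqF// subr_gt0.
have aeEE : \forall w \ae P x, ((E `&` S) `|` (E' `&` S)) w.
  exists (~` ((E `&` S) `|` (E' `&` S))).
  have mU : measurable ((E `&` S) `|` (E' `&` S)).
    by apply: measurableU; exact: measurableI.
  by split; [exact: measurableC|rewrite probability_setC// P1 subee|].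
apply: filterS aeEE => w [[Ew Sw]|[E'w Sw]]; first by left; exact: EH.
by right; exact: missE.
Qed.

End formula.

(** * The conditional expectation *)

Lemma is_cond_exp_ae (R : realType) (d : measure_display)
    (Omega : measurableType d) (Q : probability Omega R)
    (G : set_system Omega) (Z0 Z V : Omega -> \bar R) :
  G `<=` measurable -> measurable_fun setT Z -> (forall w, 0 <= Z w) ->
  (\forall w \ae Q, Z0 w = Z w) ->
  is_cond_exp Q G Z0 V -> is_cond_exp Q G Z V.
Proof.
move=> GM mZ Z_ge0 ZZ [[mZ0 Z0_ge0] VG V0 VZ]; split => // A GA.
have mA : measurable A := GM _ GA.
rewrite VZ//; apply: ge0_ae_eq_integral => //; try exact: measurable_funTS.
by apply: filterS ZZ => w E _.
Qed.

Section conditional.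
Context (R : realType) (d : measure_display) (Omega : measurableType d).
Context (l r : \bar R) (X : R -> Omega -> \bar R) (theta : R -> Omega -> Omega).
Context (P : \bar R -> probability Omega R) (s : \bar R -> \bar R).
Implicit Types (u v t : R) (a b c x y z : \bar R) (w : Omega).
Hypothesis hlr : l < r.
Hypothesis hX : regular_diffusion l r X P theta.
Hypothesis hs : scale_function l r X P s.

Let sX := diffusion_itv hX.
Let cX := diffusion_cont hX.
Let aX := diffusion_absorb hX.

Lemma measurable_scale : measurable_fun (state_space l r) s.
Proof.
have mS := measurable_state_space l r.
apply: (measurability _ (ErealGenOInfty.measurableE R)).
move=> _ [_ [c ->] <-].
rewrite [X in measurable X](_ : _ = state_space l r `&`
    [set x | exists2 x', state_space l r x' /\ x' <= x & c%:E < s x']).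
  apply: measurableI => //; apply: measurable_upper => p q pq [x' [sx' x'p] cx'].
  by exists x' => //; split => //; exact: le_trans pq.
apply/seteqP; split => x [sx /=]; rewrite ?in_itv /= ?leey ?andbT.
  by move=> cx; split => //; exists x.
move=> [x' [/andP[lx' x'r] x'x] cx']; split => //; rewrite ?in_itv /= ?leey ?andbT.
apply: (lt_le_trans cx'); move: x'x; rewrite le_eqVlt => /predU1P[->//|x'x].
by apply/ltW/(scale_mono hlr hs) => //; case/andP: sx.
Qed.

Lemma measurable_scale_diff y :
  measurable_fun (state_space l r) (fun x => maxe (s x - s y) 0).
Proof.
apply: measurable_maxe; last exact: measurable_cst.
by apply: emeasurable_funD; [exact: measurable_scale|exact: measurable_cst].
Qed.

Lemma clean_hit_shift y z t w : (0 <= t)%R ->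
  clean_hit r y z 0 (X ^~ (theta t w)) <-> clean_hit r y z t (X ^~ w).
Proof.
move=> t0; have sh u : (0 <= u)%R -> X u (theta t w) = X (u + t)%R w.
  by move=> u0; rewrite (diffusion_shift hX).
rewrite /clean_hit; case: ifP => _; split.
- move=> [tu ny]; split.
    move=> c /tu[n hn]; exists (n + Num.bound t)%N => u; rewrite natrD => nu.
    have tb : (t < (Num.bound t)%:R)%R by exact: archi_boundP.
    have nt : (n%:R <= u - t)%R by rewrite lerBrDr (le_trans _ nu)// lerD2l ltW.
    by have := hn _ nt; rewrite sh ?subrK// (le_trans _ nt).
  move=> u tu'; have ut : (0 < u - t)%R by rewrite subr_gt0.
  by have := ny _ ut; rewrite sh ?subrK// ltW.
- move=> [tu ny]; split.
    move=> c /tu[n hn]; exists n => u nu; rewrite sh ?(le_trans _ nu)//.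
    by apply: hn; rewrite (le_trans nu)// lerDl.
  by move=> u u0; rewrite sh ?(ltW u0)//; apply: ny; rewrite ltrDr.
- move=> [v [v0 Xv nv]]; exists (v + t)%R; split; first by rewrite ltrDr.
    by rewrite -sh// ltW.
  move=> u tu uv; have ut : (0 < u - t)%R by rewrite subr_gt0.
  have := nv (u - t)%R ut; rewrite lerBlDr uv sh ?subrK ?ltW// => /(_ isT).
  by [].
- move=> [v [tv Xv nv]]; exists (v - t)%R; split; first by rewrite subr_gt0.
    by rewrite sh ?subrK// subr_ge0 ltW.
  move=> u u0 uv; rewrite sh ?(ltW u0)//; apply: nv; first by rewrite ltrDr.
  by rewrite -lerBrDr.
Qed.

Section fixed_target.
Variables x y z : \bar R.
Hypotheses (lx : l < x) (xz : x < z) (ly : l <= y) (yz : y < z) (zr : z <= r).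
Hypothesis sz : s z < +oo.

Let lz : l < z. Proof. exact: lt_trans xz. Qed.
Let hx : state_space l r x.
Proof. by rewrite /state_space /= ltW// ltW// (lt_le_trans xz). Qed.
Let hz : l <= z <= r. Proof. by rewrite zr ltW. Qed.
Let hz' : l < z <= r. Proof. by rewrite zr lz. Qed.
Let nyz : y <> z. Proof. by move=> E; move: yz; rewrite E ltxx. Qed.
Let alive w : X 0%R w = x -> l < X 0%R w < r.
Proof. by move=> ->; rewrite lx (lt_le_trans xz). Qed.
Let nX0 w : X 0%R w = x -> X 0%R w <> z.
Proof. by move=> -> E; move: xz; rewrite E ltxx. Qed.
Let syz : 0 <= s z - s y.
Proof.
have h : s y <= s z by exact/ltW/(scale_mono hlr hs).
have szf := scale_fin_num_gt hlr hs ly yz zr sz.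
by rewrite sube_ge0 ?szf ?orbT.
Qed.

Definition clean_after t : set Omega :=
  [set w | hits_before l r X z l w /\ last_passage l r X y z w <= t%:E].

Lemma measurable_clean_after t : (0 <= t)%R -> measurable (clean_after t).
Proof.
move=> t0; have -> : clean_after t = hits_before l r X z l `&`
    [set w | last_passage l r X y z w <= t%:E] by [].
apply: measurableI.
  by apply: (measurable_hits_before sX cX aX (measurableX hX) hz); left.
exact: (measurable_last_passage_le l r cX (measurableX hX)).
Qed.

Lemma clean_afterP t w : (0 <= t)%R -> X 0%R w = x ->
  (forall u, (0 <= u)%R -> (u <= t)%R -> X u w <> z) ->
  clean_after t w <-> clean_hit r y z t (X ^~ w).
Proof.
move=> t0 Xw nz; apply: (hits_before_last_passageP hlr (@sX w) (@cX w) (@aX w)) => //.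
- exact: alive.
- by rewrite ly.
Qed.

Lemma scale_formula_last_passage :
  maxe (s x - s y) 0 = (s z - s y) *
    P x (hits_before l r X z l `&` [set w | last_passage l r X y z w = 0]).
Proof.
rewrite (scale_formula hlr hX hs (ltW lx) xz ly yz zr sz); congr (_ * _).
have -> : hits_before l r X z l `&` [set w | last_passage l r X y z w = 0] =
    clean_after 0.
  apply/seteqP; split => w [H1 /= H2]; split => //=; first by rewrite H2.
  by apply/eqP; rewrite eq_le H2 /last_passage le_max lexx.
apply: (eq_prob_start hX hx).
- exact: (natural_measurable hX (natural_clean_hit hlr hX nyz hz)).
- exact: measurable_clean_after.
- move=> w Xw; apply: iff_sym; apply: clean_afterP => // u u0 u0'.
  have -> : u = 0%R by apply/eqP; rewrite eq_le u0 u0'.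
  exact: nX0.
Qed.

Let visited t : set Omega := [set w | exists2 u, (0 <= u <= t)%R & X u w = z].

(** The process (s(X) - s(y))^+ stopped at the first visit to z, which turns out
    to be the conditional expectation on the whole of Omega. *)
Let V t w := maxe (s (if `[< visited t w >] then z else X t w) - s y) 0.

Let natural_visited t : (0 <= t)%R ->
  natural_sigma X [set v | (v <= t)%R] (visited t).
Proof.
move=> t0; apply: (@measurable_visit_cc _
  (g_sigma_algebraType (natural_gen X [set v | (v <= t)%R])) _ X) => //.
by move=> u /andP[u0 ut]; apply: natural_measurableX.
Qed.

Let natural_V t : (0 <= t)%R ->
  preimage_set_system setT (V t) measurable `<=`
  natural_sigma X [set v | (v <= t)%R].
Proof.
move=> t0; pose NT := g_sigma_algebraType (natural_gen X [set v | (v <= t)%R]).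
have mV : measurable_fun [set: NT] (V t : NT -> _).
  have -> : V t = (fun w => if `[< visited t w >] then maxe (s z - s y) 0
      else maxe (s (X t w) - s y) 0).
    by apply/funext => w; rewrite /V; case: ifP.
  apply: measurable_fun_ifT.
  - apply: (measurable_fun_bool true); rewrite setTI.
    rewrite [X in measurable X](_ : _ = visited t); first exact: natural_visited.
    by apply/seteqP; split => w /= /asboolP.
  - exact: measurable_cst.
  - apply: (measurable_comp (measurable_state_space l r) _ (measurable_scale_diff y)).
      by move=> _ [w _ <-]; exact: sX.
    by apply: natural_measurableX => /=.
move=> _ [B mB <-]; exact: mV.
Qed.

Let measurable_V t : (0 <= t)%R -> measurable_fun setT (V t).
Proof.
move=> t0 _ B mB; apply: (natural_measurable hX (J := [set v | (v <= t)%R])).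
by apply: natural_V => //; exists B.
Qed.

(** On the paths that have visited z by time t, both variables are equal to
    s z - s y.  On the others, the event clean_after t is a condition on the path
    after t, whose conditional probability is given by the Markov property at t
    and by scale_formula at the point X_t. *)
Lemma cond_exp_clean_after t : (0 <= t)%R ->
  is_cond_exp (P x) (filtration l r X P t)
    (fun w => (s z - s y) * (\1_(clean_after t) w)%:E) (V t).
Proof.
move=> t0; have mC := measurable_clean_after t0; have mV := measurable_V t0.
have mS := measurable_start hX x.
pose S := [set w | X 0%R w = x].
have V0 w : 0 <= V t w by rewrite /V le_max lexx orbT.
have Z0 w : 0 <= (s z - s y) * (\1_(clean_after t) w)%:E.
  by apply: mule_ge0 => //; rewrite lee_fin.
have mI : measurable_fun setT (fun w => (\1_(clean_after t) w)%:E : \bar R).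
  by apply/measurable_EFinP; exact: measurable_indic.
have mZ : measurable_fun setT (fun w => (s z - s y) * (\1_(clean_after t) w)%:E).
  by apply: measurable_funeM.
split => //; first by apply: subset_trans (natural_V t0) _ => A; exact: natural_filtration.
move=> A FA; have mA : measurable A := filtration_measurable hX FA.
have nS : P x (~` S) = 0 by rewrite probability_setC// (diffusion_start hX)// subee.
have onS f : measurable_fun setT f -> (forall w, 0 <= f w) ->
    \int[P x]_(w in A) f w = \int[P x]_(w in A `&` S) f w.
  move=> mf f0; rewrite (@ge0_negligible_integral _ _ _ (P x) A (~` S))//.
  - by rewrite setDE setCK.
  - exact: measurableC.
  - exact: measurable_funTS.
rewrite onS// [RHS]onS//.
have nV := natural_visited t0.
have mVis : measurable (visited t) := natural_measurable hX nV.
have mAS : measurable (A `&` S) by exact: measurableI.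
have split_visited f : measurable_fun setT f -> (forall w, 0 <= f w) ->
    \int[P x]_(w in A `&` S) f w = \int[P x]_(w in (A `&` S) `&` visited t) f w +
      \int[P x]_(w in (A `&` S) `\` visited t) f w.
  move=> mf f0; rewrite -{1}(setUIDK (A `&` S) (visited t)).
  rewrite ge0_integral_setU//; try exact: measurable_funTS.
  - exact: measurableI.
  - exact: measurableD.
  - apply/disj_setPS => w [[_ H1] [_ H2]]; exact: H2.
rewrite split_visited// [RHS]split_visited//; congr (_ + _).
  apply: eq_integral => w; rewrite inE => -[[_ Sw] vw].
  have [u /andP[u0 ut] Xu] := vw.
  have [H1 H2] := hits_before_visited hlr (@sX w) (@cX w) (@aX w) (alive Sw) y
    hz' (nX0 Sw) u0 ut Xu.
  rewrite /V asboolT//.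
  rewrite indicE mem_set; last by [].
  by rewrite mule1; apply/max_idPl.
set A' := (A `&` S) `\` visited t.
have FA' : filtration l r X P t A'.
  rewrite /A' setDE -setIA; apply: (filtrationI FA).
  apply: (@measurableI _ (g_sigma_algebraType (natural_gen X [set v | (v <= t)%R]))).
    exact: natural_start.
  exact: (@measurableC _ (g_sigma_algebraType (natural_gen X [set v | (v <= t)%R]))).
have mA' : measurable A' := filtration_measurable hX FA'.
pose E := [set w | clean_hit r y z 0 (X ^~ w)].
have nE : natural_sigma X setT E := natural_clean_hit hlr hX nyz hz.
have unvisited w : A' w -> forall u, (0 <= u)%R -> (u <= t)%R -> X u w <> z.
  by move=> [_ nv] u u0 ut Xu; apply: nv; exists u => //; rewrite u0.
transitivity (\int[P x]_(w in A') ((s z - s y) * P (X t w) E)).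
  apply: eq_integral => w; rewrite inE => Aw; have [[_ Sw] nv] := Aw.
  rewrite /V asboolF//; apply: (scale_formula hlr hX hs) => //.
    by have /andP[] := @sX w t t0.
  rewrite ltNge; apply/negP => zX.
  have [|u /andP[u0 ut] Xu] := path_IVT (@cX w) (lexx 0%R) t0 (a := z).
    by rewrite Sw (ltW xz) zX.
  exact: (unvisited w Aw u).
have mPE : measurable_fun setT (fun w => P (X t w) E).
  apply: (measurable_comp (measurable_state_space l r) _ (diffusion_kernel hX nE)).
    by move=> _ [w _ <-]; exact: sX.
  exact: (measurableX hX).
rewrite ge0_integralZl//; last exact: measurable_funTS.
rewrite ge0_integralZl//; last exact: measurable_funTS.
rewrite -(markov_property hX hx t0 FA' nE) integral_indic//; congr (_ * P x _).
apply/seteqP; split => w.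
  move=> [Aw /(clean_hit_shift y z w t0) H]; split => //.
  by apply/clean_afterP => //; [case: Aw => -[]|exact: unvisited].
move=> [H Aw]; split => //; apply/(clean_hit_shift y z w t0).
by apply/clean_afterP => //; [case: Aw => -[]|exact: unvisited].
Qed.

Lemma eq_cond_exp_clean_after t : (0 <= t)%R ->
  eq_cond_exp_on (P x) (filtration l r X P t)
    [set w | t%:E < hitting_time l r X z w]
    (fun w => maxe (s (X t w) - s y) 0)
    (fun w => (s z - s y) * (\1_(clean_after t) w)%:E).
Proof.
move=> t0; exists (V t); first exact: cond_exp_clean_after.
apply: filterS (ae_start hX hx) => w Sw tT; rewrite /V asboolF// => -[u /andP[u0 ut]].
exact: (not_visited_of_hitting_time_gt (nX0 Sw) u0 ut tT).
Qed.

End fixed_target.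

End conditional.

Section stopped.
Context (R : realType) (d : measure_display) (Omega : measurableType d).
Context (l r : \bar R) (X : R -> Omega -> \bar R) (theta : R -> Omega -> Omega).
Context (P : \bar R -> probability Omega R).
Implicit Types (u v t : R) (a b c x y z : \bar R) (w : Omega).
Hypothesis hlr : l < r.
Hypothesis hX : regular_diffusion l r X P theta.

Let sX := diffusion_itv hX.
Let cX := diffusion_cont hX.
Let aX := diffusion_absorb hX.

(** Almost surely the value at the hitting time is z if z is reached and b
    otherwise; since phi b = 0, only the event that z is reached contributes. *)
Lemma eq_cond_exp_stopped (phi : \bar R -> \bar R) x y z b t
    (D : set Omega) (Y : Omega -> \bar R) :
  b = l \/ b = r -> l <= z <= r -> l < x < r -> x <> z -> (0 <= t)%R ->
  measurable_fun (state_space l r) phi -> (forall a, 0 <= phi a) -> phi b = 0 ->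
  (\forall w \ae P x, hits_before l r X z b w \/
    (left_limit_is l r X b w /\ hitting_time l r X z w = lifetime l r X w)) ->
  eq_cond_exp_on (P x) (filtration l r X P t) D Y
    (fun w => phi z *
      (\1_[set w' | hits_before l r X z b w' /\ (last_passage l r X y z w' <= t%:E)%E] w)%:E) ->
  eq_cond_exp_on (P x) (filtration l r X P t) D Y
    (fun w => phi (stopped_value l r X z w) *
      (\1_[set w' | (last_passage l r X y z w' <= t%:E)%E] w)%:E).
Proof.
move=> hb hz hx xz t0 mphi phi0 phib aeH [V condV aeY]; exists V => //.
have hx' : state_space l r x by case/andP: hx => h1 h2; rewrite /state_space /= !ltW.
apply: is_cond_exp_ae condV.
- by move=> A; exact: (filtration_measurable hX).
- apply: emeasurable_funM.
    exact: (measurable_stopped_value hlr sX cX aX (measurableX hX)).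
  apply/measurable_EFinP; apply: measurable_indic.
  exact: (measurable_last_passage_le l r cX (measurableX hX)).
- by move=> w; apply: mule_ge0 => //; rewrite lee_fin.
apply: filterS2 (ae_start hX hx') aeH => w Xw hit.
have alive : l < X 0%R w < r by rewrite Xw.
have X0 : X 0%R w <> z by rewrite Xw.
have [H|nH] := pselect (hits_before l r X z b w).
  rewrite (stopped_value_hit hlr (@cX w) (@aX w) alive hz hb X0 H).
  have [L|L] := pselect (last_passage l r X y z w <= t%:E).
    by rewrite !indicE !mem_set.
  by rewrite !indicE !memNset//= => -[].
rewrite [in LHS]indicE memNset; last by move=> [].
rewrite mule0; case: hit => // -[H HT].
by rewrite (stopped_value_miss (@cX w) (@aX w) alive H HT) phib mul0e.
Qed.

End stopped.

Lemma sube_max0_id (R : realType) (p q : \bar R) : p < q ->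
  maxe (q - p) 0 = q - p /\ maxe (p - q) 0 = 0.
Proof.
move=> pq; split; [apply/max_idPl|apply/max_idPr].
  by case: p q pq => [p| |] [q| |] //=; rewrite ?leey// lte_fin lee_fin subr_ge0 => /ltW.
by case: p q pq => [p| |] [q| |] //=; rewrite ?leNye// lte_fin lee_fin subr_le0 => /ltW.
Qed.

Lemma sube_max0 (R : realType) (p q : \bar R) : p <= q -> maxe (p - q) 0 = 0.
Proof.
rewrite le_eqVlt => /predU1P[->|/sube_max0_id[]//]; apply/max_idPr.
by case: q => [q| |]; [rewrite subee|exact: leNye|exact: leNye].
Qed.

Theorem lemma3p1 (R : realType) (d : measure_display) (Omega : measurableType d)
    (l r : \bar R) (X : R -> Omega -> \bar R) (theta : R -> Omega -> Omega)
    (P : \bar R -> probability Omega R) (s : \bar R -> \bar R)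
    (hlr : l < r)
    (hX : regular_diffusion l r X P theta)
    (hs : scale_function l r X P s)
    (y z : \bar R) (hy : l <= y <= r) (hz : l <= z <= r) (hyz : y <> z) :
  (forall x : \bar R, l < x < r -> maxe x y < z -> s z < +oo ->
     maxe (s x - s y) 0 =
       (s z - s y) * P x (hits_before l r X z l `&`
                          [set w | last_passage l r X y z w = 0])
     /\
     forall t : R, (0 <= t)%R ->
       eq_cond_exp_on (P x) (filtration l r X P t)
         [set w | t%:E < hitting_time l r X z w]
         (fun w => maxe (s (X t w) - s y) 0)
         (fun w => maxe (s (stopped_value l r X z w) - s y) 0 *
                   (\1_[set w' | (last_passage l r X y z w' <= t%:E)%E] w)%:E))
  /\
  (forall x : \bar R, l < x < r -> z < mine x y -> -oo < s z ->
     maxe (s y - s x) 0 =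
       (s y - s z) * P x (hits_before l r X z r `&`
                          [set w | last_passage l r X y z w = 0])
     /\
     forall t : R, (0 <= t)%R ->
       eq_cond_exp_on (P x) (filtration l r X P t)
         [set w | t%:E < hitting_time l r X z w]
         (fun w => maxe (s y - s (X t w)) 0)
         (fun w => maxe (s y - s (stopped_value l r X z w)) 0 *
                   (\1_[set w' | (last_passage l r X y z w' <= t%:E)%E] w)%:E)).
Proof.
have /andP[ly yr] := hy; have /andP[lz zr] := hz.
split=> x hx; have /andP[lx xr] := hx.
- rewrite gt_max => /andP[xz yz] sz.
  split; first exact: (scale_formula_last_passage hlr hX hs lx xz ly yz zr sz).
  move=> t t0.
  apply: (eq_cond_exp_stopped hlr hX (phi := fun v => maxe (s v - s y) 0)
    (b := l)) => //; first by left.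
  + by move=> E; move: xz; rewrite E ltxx.
  + exact: (measurable_scale_diff hlr hs).
  + by move=> v; rewrite le_max lexx orbT.
  + apply: sube_max0; move: ly; rewrite le_eqVlt => /predU1P[->//|ly'].
    by apply/ltW/(scale_mono hlr hs).
  + exact: (ae_hit_or_bottom hlr hX hs lx xz zr sz).
  + have [-> _] := sube_max0_id (scale_mono hlr hs ly yz zr).
    exact: (eq_cond_exp_clean_after hlr hX hs lx xz ly yz zr sz t0).
- rewrite lt_min => /andP[zx zy] sz.
  have hX' := reflect_diffusion hX; have hs' := reflect_scale hX hs.
  have rl : - r < - l by rewrite lteN2.
  have rx' : - r < - x by rewrite lteN2.
  have xz' : - x < - z by rewrite lteN2.
  have ry' : - r <= - y by rewrite leeN2.
  have yz' : - y < - z by rewrite lteN2.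
  have zl' : - z <= - l by rewrite leeN2.
  have sz' : - s (- - z) < +oo by rewrite oppeK lteNl.
  have eH : hits_before (- r) (- l) (fun u w => - X u w) (- z) (- r) =
      hits_before l r X z r.
    by apply/funext => w; rewrite hits_before_reflect !oppeK.
  have eL : last_passage (- r) (- l) (fun u w => - X u w) (- y) (- z) =
      last_passage l r X y z.
    by apply/funext => w; rewrite last_passage_reflect !oppeK.
  have eT : hitting_time (- r) (- l) (fun u w => - X u w) (- z) =
      hitting_time l r X z.
    by apply/funext => w; rewrite hitting_time_reflect oppeK.
  split.
    have := scale_formula_last_passage rl hX' hs' rx' xz' ry' yz' zl' sz'.
    by rewrite eH eL /= !oppeK (addeC _ (s y)) (addeC _ (s y)).
  move=> t t0.
  apply: (eq_cond_exp_stopped hlr hX (phi := fun v => maxe (s y - s v) 0)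
    (b := r)) => //; first by right.
  + by move=> E; move: zx; rewrite E ltxx.
  + apply: measurable_maxe; last exact: measurable_cst.
    apply: emeasurable_funB; first exact: measurable_cst.
    exact: (measurable_scale hlr hs).
  + by move=> v; rewrite le_max lexx orbT.
  + apply: sube_max0; move: yr; rewrite le_eqVlt => /predU1P[->//|yr'].
    by apply/ltW/(scale_mono hlr hs).
  + have := ae_hit_or_bottom rl hX' hs' rx' xz' zl' sz'.
    rewrite oppeK; apply: filterS => w.
    by rewrite eH eT left_limit_is_reflect lifetime_reflect oppeK.
  + have [-> _] := sube_max0_id (scale_mono hlr hs lz zy yr).
    have := eq_cond_exp_clean_after rl hX' hs' rx' xz' ry' yz' zl' sz' t0.
    rewrite /clean_after eH eL eT (filtration_reflect hX) /= !oppeK (addeC _ (s y)).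
    have -> // : (fun w => maxe (- s (- - X t w) + s y) 0) =
      (fun w => maxe (s y - s (X t w)) 0).
    by apply/funext => w; rewrite oppeK addeC.
Qed.
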